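(* For each $M,L$ let $\mathbf{A}_{M,L}\in\mathbb{C}^{ML\times ML}$ be a Hermitian matrix with $M\times M$ blocks $[\mathbf{A}_{M,L}]_{i,j}=\mathbf{A}_M^{(i,j)}$, $\mathbf{A}_M^{(i,j)}=(\mathbf{A}_M^{(j,i)})^\dagger$, $i,j=1,\dots,L$, such that the matrices $\mathbf{A}_{M,L}$ have uniformly bounded spectral norm. Let $\mathbf{x}_1,\mathbf{x}_2,\dots$ with $\mathbf{x}_L\in\mathbb{C}^L$ be random vectors with i.i.d. entries of zero mean, variance $1$ and finite eighth order moment, independent of $\mathbf{A}_{M,L}$, and let $\mathbf{X}_{M,L}=\mathbf{x}_L\otimes\mathbf{I}_M\in\mathbb{C}^{ML\times M}$. Then $$\frac1L\big\|\mathbf{X}_{M,L}^\dagger\mathbf{A}_{M,L}\mathbf{X}_{M,L}-\operatorname{blktr}[\mathbf{A}_{M,L}]\big\|\longrightarrow0\quad\text{almost surely as }L\to\infty.$$ Assume furthermore that the entries of $\mathbf{x}_L=(x_1,\dots,x_L)^T$ are bounded almost surely, i.e. there exists $\chi>0$ such that $|x_i|\le\chi$ a.s. for $i=1,\dots,L$. Then, if $\limsup_{L,M}ML^{-\delta}<\infty$ for some $0<\delta<1$, $$\frac1L\big\|\mathbf{X}_{M,L}^\dagger\mathbf{A}_{M,L}\mathbf{X}_{M,L}-\operatorname{blktr}[\mathbf{A}_{M,L}]\big\|\longrightarrow0\quad\text{almost surely as }L,M\to\infty.$$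
   Context: $\|\cdot\|$ is the spectral norm and $\dagger$ the conjugate transpose. For $\mathbf{B}\in\mathbb{C}^{ML\times ML}$ partitioned into $M\times M$ blocks $\mathbf{B}^{(i,j)}$, $1\le i,j\le L$, the block-trace is $\operatorname{blktr}[\mathbf{B}]=\sum_{i=1}^L\mathbf{B}^{(i,i)}\in\mathbb{C}^{M\times M}$. In the first convergence $M$ is fixed. *)

(* Defs.v *)
From HB Require Import structures.
#[export] Set Warnings "-notation-overridden,-notation-incompatible-prefix".
From mathcomp Require Export all_boot all_order all_algebra.
From mathcomp Require Export sesquilinear spectral complex.
From mathcomp Require mxtens.
From mathcomp Require Export all_classical all_reals all_analysis.

Set Implicit Arguments.
Unset Strict Implicit.
Unset Printing Implicit Defensive.

Import Order.TTheory GRing.Theory Num.Theory.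
Import numFieldNormedType.Exports.

Local Open Scope classical_set_scope.
Local Open Scope complex_scope.
Local Open Scope sesquilinear_scope.
Local Open Scope ring_scope.

Section SpectralNorm.
Context {R : realType}.

Definition cnorm2 n (v : 'cV[R[i]]_n) : R :=
  Num.sqrt (\sum_(i < n) Normc.normc (v i 0) ^+ 2).

(* Norms on matrices from the library are entrywise maxima; the spectral norm
   is the one induced by the Euclidean norms. The unit ball (not the sphere)
   keeps the set nonempty when n = 0. *)
Definition spectral_norm m n (A : 'M[R[i]]_(m, n)) : R :=
  sup [set cnorm2 (A *m v) | v in [set v : 'cV[R[i]]_n | cnorm2 v <= 1]].

End SpectralNorm.

Section Blocks.
Context {R : realType}.

(* Rows and columns of an (L * M)-square matrix are numbered as in the Kronecker
   product [tensmx]: [mxtens_index (i, a)] is row a of block row i. *)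
Definition blk L M (B : 'M[R[i]]_(L * M)) (i j : 'I_L) : 'M[R[i]]_M :=
  \matrix_(a, b) B (mxtens.mxtens_index (i, a)) (mxtens.mxtens_index (j, b)).

Definition blktr L M (B : 'M[R[i]]_(L * M)) : 'M[R[i]]_M :=
  \sum_(i < L) blk B i i.

(* The Kronecker product of x with the identity; the cast is along 1 * M = M. *)
Definition kron_id L M (x : 'cV[R[i]]_L) : 'M[R[i]]_(L * M, M) :=
  castmx (erefl (L * M)%N, mul1n M) (mxtens.tensmx x (1%:M : 'M[R[i]]_M)).

Definition normalized_dev L M (x : 'cV[R[i]]_L) (A : 'M[R[i]]_(L * M)) : R :=
  L%:R^-1 * spectral_norm ((kron_id M x)^t* *m A *m kron_id M x - blktr A).

End Blocks.

Section ComplexRandomVariables.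
Context {d : measure_display} {T : measurableType d} {R : realType}.
Variable P : probability T R.

(* The Borel sets of the complex numbers, identified with R * R. *)
Definition complex_borel : set (set R[i]) :=
  [set B | measurable
     [set p : measurableTypeR R * measurableTypeR R | B (p.1 +i* p.2)]].

Definition complex_rv (X : T -> R[i]) : Prop :=
  forall B, complex_borel B -> measurable (X @^-1` B).

(* Mutual independence. Taking [B i = setT] outside a subset of the indices
   gives the product rule over that subset. *)
Definition mutually_independent (I : finType) (X : I -> T -> R[i]) : Prop :=
  forall B : I -> set R[i], (forall i, complex_borel (B i)) ->
    P (\bigcap_i (X i @^-1` B i)) = (\prod_i P (X i @^-1` B i))%E.

Definition identically_distributed (I : Type) (X : I -> T -> R[i]) : Prop :=
  forall i j B, complex_borel B -> P (X i @^-1` B) = P (X j @^-1` B).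

Definition sigma_generated (I : Type) (X : I -> T -> R[i]) : set (set T) :=
  <<s [set E | exists i B, complex_borel B /\ E = X i @^-1` B] >>.

Definition independent_families (I J : Type)
    (X : I -> T -> R[i]) (Y : J -> T -> R[i]) : Prop :=
  forall E F, sigma_generated X E -> sigma_generated Y F ->
    P (E `&` F) = (P E * P F)%E.

End ComplexRandomVariables.

Definition entry {T R : Type} m n (A : T -> 'M[R]_(m, n))
  (ij : 'I_m * 'I_n) (w : T) : R := A w ij.1 ij.2.

(* Main.v *)
(** The spectral norm of D = X^* A X - blktr A is at most its Frobenius norm.
    The entries of D are quadratic forms in the x_i with their mean removed,
    hence multilinear in the centered variables Re x_i, Im x_i and |x_i|^2 - 1.
    Revealing the x_i one at a time and using that
    E |u + z|^(2p) <= E (|u|^2 + C |v|^2)^p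
    when z is linear in the centered variables of x_i with coefficients v, and
    (u, v) only depends on A and on the x_j with j < i, one gets by induction
    E |D|_F^(2p) <= C_p E |A|_F^(2p) <= C_p (K^2 L M)^p,
    a hypercontractive estimate which needs 4p moments of the x_i. Hence
    E (|D|_F / L)^(2p) is at most of order (M / L)^p, and for p = 2 and M fixed,
    or for p (1 - delta) >= 3 and M = O(L^delta), this is summable over the
    relevant pairs (M, L). *)

Require Import Defs.
From mathcomp Require Import ring lra measurable_realfun.

Import Order.TTheory GRing.Theory Num.Theory.
Import numFieldNormedType.Exports.
Local Open Scope classical_set_scope.
Local Open Scope ring_scope.
Local Open Scope complex_scope.

Set Implicit Arguments.
Unset Strict Implicit.
Unset Printing Implicit Defensive.

(** The step inequality is applied L times, so its constant must never multiply |u|^2. This is why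
    its right-hand side has the form (|u|^2 + D)^p with D = C |v|^2 and coefficient 1 on |u|^2:
    expanding |u + z|^(2p) around U = |u|^2 leaves a linear term of mean zero, and all other errors
    have the shape U^(p-1) D or D^p, for which the expansion of (U + D)^p has room. A monomial
    collects one factor C per variable, and the form has degree two, so the final constant involves
    C^2 and is free of L and M.

    The matrix A is random. Instead of conditioning on it, its entries are put into the initial
    sigma-algebra and serve as random coefficients; the bound on its norm enters only when all x_i
    have been integrated out.

    No joint law of the x_L for different L is given, so almost sure convergence has to come from
    summable expectations alone. *)

Section OneStepInequality.
Context {R : realFieldType}.
Implicit Types U D W Y : R.

(** * Elementary inequalities behind the one-variable step *)

Lemma exprD_ge p U D : (0 < p)%N -> 0 <= U -> 0 <= D ->
  U ^+ p + D ^+ p <= (U + D) ^+ p.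
Proof.
case: p => // p _ U0 D0; elim: p => [|p IH]; first by rewrite !expr1.
rewrite 3!(exprS _ p.+1).
apply: (@le_trans _ _ ((U + D) * (U ^+ p.+1 + D ^+ p.+1))); last first.
  by rewrite ler_wpM2l ?addr_ge0.
rewrite mulrDl !mulrDr lerD// ?lerDl ?lerDr mulr_ge0// exprn_ge0//.
Qed.

(** One power of [U + D] has room for both error shapes produced by [one_step]; it is used with [D]
    a multiple of |v|^2. *)
Lemma exprD_ge_cross p U D : (1 < p)%N -> 0 <= U -> 0 <= D ->
  U ^+ p + (U ^+ p.-1 * D + D ^+ p) <= (U + D) ^+ p.
Proof.
case: p => // -[//|p] _ U0 D0.
rewrite (exprS (U + D)) /=.
apply: (@le_trans _ _ ((U + D) * (U ^+ p.+1 + D ^+ p.+1))); last first.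
  by rewrite ler_wpM2l ?addr_ge0// exprD_ge.
have U1 : 0 <= U ^+ p.+1 by rewrite exprn_ge0.
have D1 : 0 <= D ^+ p.+1 by rewrite exprn_ge0.
by rewrite !exprS in U1 D1 *; nra.
Qed.

(** The recursion comes from multiplying the bound of [exprD_taylor] by [U + h <= 4 * U]: the old
    remainder gains a factor 4, and the new term in [h ^+ 2] costs 10 times the coefficient of the
    linear term. *)
Fixpoint taylor_cst p : R :=
  if p is p'.+1 then 10 * p'%:R + 4 * taylor_cst p' else 0.

Lemma taylor_cst_ge0 p : 0 <= taylor_cst p.
Proof. by elim: p => //= p IH; rewrite addr_ge0 ?mulr_ge0. Qed.

Lemma exprD_taylor p U h Y : 0 <= U -> 0 <= U + h -> 0 <= Y ->
  h <= 3 * U -> h ^+ 2 <= 10 * (U * Y) ->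
  (U + h) ^+ p.+1
    <= U ^+ p.+1 + p.+1%:R * U ^+ p * h + taylor_cst p.+1 * (U ^+ p * Y).
Proof.
move=> U0 Uh0 Y0 hU h2; elim: p => [|p IH].
  by rewrite !expr1 expr0 /=; lra.
rewrite exprS (le_trans (ler_wpM2l Uh0 IH))//.
have e0 : 0 <= U ^+ p by rewrite exprn_ge0.
have H1 : p.+1%:R * U ^+ p * h ^+ 2 <= p.+1%:R * U ^+ p * (10 * (U * Y)).
  by rewrite ler_wpM2l// mulr_ge0.
have H2 : (h - 3 * U) * (taylor_cst p.+1 * (U ^+ p * Y)) <= 0.
  rewrite mulr_le0_ge0// ?subr_le0// mulr_ge0 ?taylor_cst_ge0//.
  by rewrite mulr_ge0.
(* The gap between the two sides is exactly the sum of the slacks in [H1] and [H2]. *)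
have E : U ^+ p.+2 + p.+2%:R * U ^+ p.+1 * h
    + taylor_cst p.+2 * (U ^+ p.+1 * Y)
    - (U + h) * (U ^+ p.+1 + p.+1%:R * U ^+ p * h
      + taylor_cst p.+1 * (U ^+ p * Y))
  = (p.+1%:R * U ^+ p * (10 * (U * Y)) - p.+1%:R * U ^+ p * h ^+ 2)
    - (h - 3 * U) * (taylor_cst p.+1 * (U ^+ p * Y)).
  rewrite [taylor_cst p.+2]/= -[10 * p%:R + _]/(taylor_cst p.+1) !exprS.
  by rewrite -(natr1 p.+1); ring.
by rewrite -subr_ge0 E; lra.
Qed.

(** The first two terms serve the case [Y <= U] of [one_step] (Taylor remainder, and the linear
    contribution of [S]); the last two serve [U <= Y] (crude bound by [4 * Y], and a negative linear
    term). *)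
Definition step_cst p : R := taylor_cst p.+1 + p.+1%:R + 4 ^+ p.+1 + 2 * p.+1%:R.

Lemma step_cst_ge1 p : 1 <= step_cst p.
Proof.
have := taylor_cst_ge0 p.+1; have : 1 <= p.+1%:R :> R by rewrite ler1n.
have : 0 <= (4 : R) ^+ p.+1 by rewrite exprn_ge0.
by rewrite /step_cst; lra.
Qed.

(* With N = |u + z|^2, U = |u|^2, W = <u, z>, S = |z|^2 and Y a bound for S, the
   right-hand side is linear in W: the linear term has zero mean as soon as z is
   centered given u. The cases Y <= U and U <= Y are treated separately. *)
Lemma one_step p U W S Y : 0 <= U -> 0 <= S <= Y -> W ^+ 2 <= U * Y ->
  0 <= U + 2 * W + S ->
  (U + 2 * W + S) ^+ p.+1 <=
    U ^+ p.+1 + p.+1%:R * 2 * (U ^+ p * W)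
    + step_cst p * (U ^+ p * Y + Y ^+ p.+1).
Proof.
move=> U0 /andP[S0 SY] W2 N0.
have Y0 : 0 <= Y by exact: le_trans SY.
have e0 : 0 <= U ^+ p by rewrite exprn_ge0.
have e1 : 0 <= Y ^+ p.+1 by rewrite exprn_ge0.
have t0 := taylor_cst_ge0 p.+1.
have f0 : 0 <= (4 : R) ^+ p.+1 by rewrite exprn_ge0.
have UY0 : 0 <= U ^+ p * Y by rewrite mulr_ge0.
have p0 : 0 <= p.+1%:R :> R by [].
have [YU|/ltW UY] := leP Y U.
  have WU : W <= U.
    by rewrite leNgt; apply/negP => UW; nra.
  have W2' : W ^+ 2 <= U ^+ 2 by nra.
  have hU : 2 * W + S <= 3 * U by lra.
  (* The 10 is 8 + 2: (2W + S)^2 <= 8 W^2 + 2 S^2, where W^2 <= U Y and S^2 <= Y^2 <= U Y. *)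
  have h2 : (2 * W + S) ^+ 2 <= 10 * (U * Y).
    have := sqr_ge0 (2 * W - S); rewrite !expr2 in W2 *.
    have : S * S <= U * Y by nra.
    by lra.
  have Uh0 : 0 <= U + (2 * W + S) by rewrite addrA.
  rewrite -addrA (le_trans (exprD_taylor p U0 Uh0 Y0 hU h2))//.
  have HS : p.+1%:R * U ^+ p * S <= p.+1%:R * (U ^+ p * Y).
    by rewrite -mulrA ler_wpM2l// ler_wpM2l.
  have H4 : 0 <= (4 ^+ p.+1 + 2 * p.+1%:R) * (U ^+ p * Y).
    by rewrite mulr_ge0// addr_ge0// mulr_ge0.
  have H5 : 0 <= step_cst p * Y ^+ p.+1.
    by rewrite mulr_ge0// (le_trans ler01)// step_cst_ge1.
  rewrite -subr_ge0.
  rewrite (_ : _ - _ = (p.+1%:R * (U ^+ p * Y) - p.+1%:R * U ^+ p * S)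
    + (4 ^+ p.+1 + 2 * p.+1%:R) * (U ^+ p * Y) + step_cst p * Y ^+ p.+1).
    by lra.
  by rewrite /step_cst; ring.
have WY : - Y <= W by rewrite leNgt; apply/negP => UW; nra.
have WY' : W <= Y by rewrite leNgt; apply/negP => UW; nra.
have NY : U + 2 * W + S <= 4 * Y by lra.
have H1 : (U + 2 * W + S) ^+ p.+1 <= 4 ^+ p.+1 * Y ^+ p.+1.
  by rewrite -exprMn lerXn2r ?nnegrE ?mulr_ge0.
have UYp : U ^+ p <= Y ^+ p by rewrite lerXn2r.
(* The linear term has to stay in the bound, since it is its mean that vanishes. Where it is
   negative, the summand [2 * p.+1%:R] of the constant compensates it. *)
have H2 : - Y ^+ p.+1 <= U ^+ p * W.
  rewrite (@le_trans _ _ (U ^+ p * - Y))//; last by rewrite ler_wpM2l.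
  by rewrite mulrN lerN2 exprSr ler_wpM2r.
have H3 : - (p.+1%:R * 2 * Y ^+ p.+1) <= p.+1%:R * 2 * (U ^+ p * W).
  by rewrite -mulrN ler_wpM2l.
have H4 : 0 <= (taylor_cst p.+1 + p.+1%:R) * Y ^+ p.+1.
  by rewrite mulr_ge0// addr_ge0.
have H5 : 0 <= step_cst p * (U ^+ p * Y).
  by rewrite mulr_ge0// (le_trans ler01)// step_cst_ge1.
have H6 : 0 <= U ^+ p.+1 by rewrite exprn_ge0.
rewrite (le_trans H1)// -subr_ge0.
rewrite (_ : _ - _ = U ^+ p.+1
   + (p.+1%:R * 2 * (U ^+ p * W) + p.+1%:R * 2 * Y ^+ p.+1)
   + (taylor_cst p.+1 + p.+1%:R) * Y ^+ p.+1 + step_cst p * (U ^+ p * Y)).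
  by lra.
by rewrite /step_cst; ring.
Qed.

End OneStepInequality.

Lemma measurable_preimageT d d' (aT : measurableType d) (rT : measurableType d')
    (f : aT -> rT) : measurable_fun setT f ->
  forall B, measurable B -> measurable (f @^-1` B).
Proof. by move=> mf B mB; rewrite -[X in measurable X]setTI; exact: mf. Qed.

(** * Independence and expectations of products *)

Section Independence.
Context d (T : measurableType d) (R : realType) (P : probability T R).
Local Open Scope ereal_scope.

Definition independent_events (G H : set (set T)) :=
  forall E F, G E -> H F -> P (E `&` F) = P E * P F.

(** For fixed F, the finite measures E -> P(E & F) and E -> P(E) P(F) agree on the pi-system [G],
    which contains the whole space, hence on the sigma-algebra that it generates. *)
Lemma independent_events_sigmal (G H : set (set T)) :
  G `<=` measurable -> H `<=` measurable -> G setT -> setI_closed G ->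
  independent_events G H -> independent_events <<s G >> H.
Proof.
move=> Gm Hm GT GI GH E F sGE HF.
have mF := Hm _ HF.
pose r : {nonneg R} := NngNum (fine_ge0 (measure_ge0 P F)).
have rE : (r%:num)%:E = P F by rewrite /r /= fineK// fin_num_measure.
pose m2 : {measure set T -> \bar R} := mscale r P.
pose m1 : {measure set T -> \bar R} := mrestr P mF.
have := @g_sigma_algebra_measure_unique _ _ _ G Gm (fun=> setT) _ _ m1 m2 _ _ _ E sGE.
rewrite /m1 /m2 /= /mrestr /mscale -/r muleC rE; apply => //.
- by rewrite bigcup_const//; exists 0%N.
- by move=> A GA; rewrite [RHS]muleC; exact: GH.
- move=> _; rewrite -[ltLHS]/(P (setT `&` F)) setTI.
  by rewrite -ge0_fin_numE// fin_num_measure.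
Qed.

Definition rv_indep (Y Z : T -> R) := forall B C : set R,
  measurable B -> measurable C ->
  P (Y @^-1` B `&` Z @^-1` C) = P (Y @^-1` B) * P (Z @^-1` C).

Section product_law.
Variables Y Z : {mfun T >-> R}.
Hypothesis YZ : rv_indep Y Z.

Let pair_mfun : measurable_fun setT (fun w => (Y w, Z w)).
Proof. exact: measurable_fun_pair. Qed.

Let W : {mfun T >-> (R * R)%type} := mfun_Sub (mem_set pair_mfun).

(** The law of the pair agrees with the product law on rectangles, which determine it. *)
Lemma ge0_integral_pair_indep (f : R * R -> \bar R) :
  measurable_fun setT f -> (forall z, 0 <= f z) ->
  \int[P]_w f (Y w, Z w) =
  \int[distribution P Y \x distribution P Z]_z f z.
Proof.
move=> mf f0.
rewrite -(@ge0_integral_distribution _ _ _ _ _ P W f mf f0).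
apply: eq_measure_integral => B mB _; symmetry.
have H : forall A C : set R, measurable A -> measurable C ->
  distribution P W (A `*` C) = distribution P Y A * distribution P Z C by exact: YZ.
exact: (product_measure_unique H mB).
Qed.

Lemma ge0_integralM_indep : (forall w, 0 <= Y w)%R -> (forall w, 0 <= Z w)%R ->
  \int[P]_w (Y w * Z w)%:E = (\int[P]_w (Y w)%:E) * (\int[P]_w (Z w)%:E).
Proof.
move=> Y0 Z0.
(* The absolute values make the integrand nonnegative on the whole plane, as Tonelli requires, and
   change nothing on the range of (Y, Z). *)
pose f (z : R * R) : \bar R := (`|z.1| * `|z.2|)%:E.
have mf : measurable_fun setT f.
  apply/measurable_EFinP; apply: measurable_funM;
    by apply: measurableT_comp => //; exact: normr_measurable.
transitivity (\int[P]_w f (Y w, Z w)).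
  by apply: eq_integral => w _; rewrite /f /= !ger0_norm.
rewrite ge0_integral_pair_indep//; last by move=> z; rewrite lee_fin mulr_ge0.
rewrite fubini_tonelli1//; last by move=> z; rewrite lee_fin mulr_ge0.
have mn : measurable_fun [set: R] (fun x : R => `|x|%:E).
  by apply/measurable_EFinP; exact: normr_measurable.
have EY (X : {mfun T >-> R}) : (forall w, 0 <= X w)%R ->
    \int[distribution P X]_y `|y|%:E = \int[P]_w (X w)%:E.
  move=> X0.
  rewrite (@ge0_integral_distribution _ _ _ _ _ P X (fun y => `|y|%:E)) //.
  by apply: eq_integral => w _ /=; rewrite ger0_norm.
under eq_integral => y _.
  rewrite /fubini_F /f /=.
  under eq_integral do rewrite EFinM.
  rewrite ge0_integralZl//.
  rewrite EY//.
  over.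
by rewrite /= ge0_integralZr// ?EY// integral_ge0// => w _; rewrite lee_fin.
Qed.

(** By Fubini for the product law: the inner integral in the second variable vanishes for every
    value of the first. *)
Lemma integralM_indep_eq0 : P.-integrable setT (EFin \o Y) ->
  P.-integrable setT (EFin \o Z) -> \int[P]_w (Z w)%:E = 0 ->
  P.-integrable setT (EFin \o (Y \* Z)%R) ->
  \int[P]_w (Y w * Z w)%:E = 0.
Proof.
move=> iY iZ Z0 iYZ.
pose f (z : R * R) : \bar R := (z.1 * z.2)%:E.
have mf : measurable_fun setT f.
  by apply/measurable_EFinP; apply: measurable_funM.
rewrite -[LHS]/(\int[P]_w (f \o W) w).
have H : forall A C : set R, measurable A -> measurable C ->
  distribution P W (A `*` C) = distribution P Y A * distribution P Z C by exact: YZ.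
have iW : (distribution P W).-integrable setT f by exact: integrable_pushforward.
rewrite -(@integral_distribution _ _ _ _ _ P W f mf)//.
have iYxZ : (distribution P Y \x distribution P Z).-integrable setT f.
  apply/integrableP; split=> //; move/integrableP : iW => [_]; apply: le_lt_trans.
  rewrite le_eqVlt; apply/orP; left; apply/eqP.
  by apply: eq_measure_integral => B mB _; exact: (product_measure_unique H mB).
transitivity (\int[distribution P Y \x distribution P Z]_z f z).
  apply: eq_measure_integral => B mB _; symmetry.
  exact: (product_measure_unique H mB).
rewrite -integral12_prod_meas1// integral0_eq// => y _.
rewrite /fubini_F /f /=.
under eq_integral do rewrite EFinM.
have mE : measurable_fun [set: R] (EFin : R -> \bar R).
  by apply/(@measurable_EFinP _ _ _ _ id); exact: measurable_id.
rewrite integralZl//; last exact: integrable_pushforward.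
by rewrite (@integral_distribution _ _ _ _ _ P Z EFin mE)//= Z0 mule0.
Qed.

End product_law.

Lemma rv_indep_comp (Y Z : T -> R) (f g : R -> R) : measurable_fun [set: R] f ->
  measurable_fun [set: R] g -> rv_indep Y Z -> rv_indep (f \o Y) (g \o Z).
Proof.
move=> mf mg YZ B C mB mC.
exact: YZ (measurable_preimageT mf mB) (measurable_preimageT mg mC).
Qed.

(** Integrability of the product comes from independence, not from second moments: the nonnegative
    product rule is applied to |Y| and |Z|. *)
Lemma indep_integralM_eq0 (Y Z : T -> R) : rv_indep Y Z ->
  P.-integrable setT (EFin \o Y) -> P.-integrable setT (EFin \o Z) ->
  P.-integrable setT (EFin \o (Y \* Z)%R) /\
  (\int[P]_w (Z w)%:E = 0 -> \int[P]_w (Y w * Z w)%:E = 0).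
Proof.
move=> YZ iY iZ.
have /measurable_EFinP mY := measurable_int _ iY.
have /measurable_EFinP mZ := measurable_int _ iZ.
have mn := @normr_measurable R setT.
pose nY : {mfun T >-> R} := mfun_Sub (mem_set (measurableT_comp mn mY)).
pose nZ : {mfun T >-> R} := mfun_Sub (mem_set (measurableT_comp mn mZ)).
have iYZ : P.-integrable setT (EFin \o (Y \* Z)%R).
  apply/integrableP; split; first by apply/measurable_EFinP; exact: measurable_funM.
  under eq_integral do rewrite /= normrM.
  have := @ge0_integralM_indep nY nZ (rv_indep_comp mn mn YZ).
  move=> -> /=; try by move=> w; exact: normr_ge0.
  move/integrableP : iY => [_ iY]; move/integrableP : iZ => [_ iZ].
  by rewrite lte_mul_pinfty// ?integral_ge0// ge0_fin_numE ?integral_ge0.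
split=> // Z0.
by apply: (@integralM_indep_eq0 (mfun_Sub (mem_set mY)) (mfun_Sub (mem_set mZ))).
Qed.

Lemma ge0_indep_integralM (Y Z : T -> R) : rv_indep Y Z ->
  measurable_fun setT Y -> measurable_fun setT Z ->
  (forall w, 0 <= Y w)%R -> (forall w, 0 <= Z w)%R ->
  \int[P]_w (Y w * Z w)%:E = (\int[P]_w (Y w)%:E) * (\int[P]_w (Z w)%:E).
Proof.
move=> YZ mY mZ Y0 Z0.
by apply: (@ge0_integralM_indep (mfun_Sub (mem_set mY)) (mfun_Sub (mem_set mZ))).
Qed.

End Independence.

(** Lagrange's identity: the double sum of (a_i b_j - a_j b_i)^2 is twice the gap. *)
Lemma cauchy_schwarz_sum (R : realFieldType) (J : finType) (a b : J -> R) :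
  (\sum_j a j * b j) ^+ 2 <= (\sum_j a j ^+ 2) * (\sum_j b j ^+ 2).
Proof.
have : 0 <= \sum_i \sum_j (a i * b j - a j * b i) ^+ 2.
  by apply: sumr_ge0 => i _; apply: sumr_ge0 => j _; exact: sqr_ge0.
rewrite (_ : \sum_i _ = 2 * ((\sum_j a j ^+ 2) * (\sum_j b j ^+ 2)
  - (\sum_j a j * b j) ^+ 2)); first by rewrite pmulr_rge0// subr_ge0.
transitivity (\sum_i (a i ^+ 2 * (\sum_j b j ^+ 2)
  + (b i ^+ 2 * (\sum_j a j ^+ 2) - 2 * (a i * b i) * (\sum_j a j * b j)))).
  apply: eq_bigr => i _; rewrite !mulr_sumr -sumrB -big_split/=.
  by apply: eq_bigr => j _; ring.
by rewrite big_split/= sumrB -!mulr_suml -mulr_sumr; ring.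
Qed.

Section Adapted.
Context d (T : measurableType d) (R : realType) (P : probability T R).
Implicit Types (G : set (set T)) (f : T -> R).

Definition adapted G f := measurable_fun (setT : set (g_sigma_algebraType G)) f.

Lemma adapted_measurable G f : G `<=` measurable -> adapted G f ->
  measurable_fun setT f.
Proof.
move=> Gm Gf _ B mB; have := Gf measurableT B mB.
rewrite /measurable /=; apply: smallest_sub => //; exact: sigma_algebra_measurable.
Qed.

Lemma adapted_indep G G' Y Z : independent_events P <<s G >> <<s G' >> ->
  adapted G Y -> adapted G' Z -> rv_indep P Y Z.
Proof.
move=> GG' aY aZ B C mB mC; apply: GG'.
  by have := aY measurableT B mB; rewrite setTI.
by have := aZ measurableT C mC; rewrite setTI.
Qed.

Lemma adapted_sub G G' f : G `<=` <<s G' >> -> adapted G f -> adapted G' f.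
Proof.
move=> GG' aY _ B mB; have := aY measurableT B mB; rewrite !setTI.
rewrite /measurable /=; apply: smallest_sub => //; exact: smallest_sigma_algebra.
Qed.

End Adapted.

Section Centered.
Context d (T : measurableType d) (R : realType) (P : probability T R).
Implicit Types (f g : T -> R).
Local Open Scope ereal_scope.

Definition centered f :=
  P.-integrable setT (EFin \o f) /\ \int[P]_w (f w)%:E = 0.

Lemma centered0 : centered (fun=> 0%R).
Proof. by split; [exact: integrable0|exact: integral0]. Qed.

Lemma centeredD f g : centered f -> centered g -> centered (fun w => f w + g w)%R.
Proof.
move=> [f1 f2] [g1 g2]; split.
  by rewrite /comp; under eq_fun do rewrite EFinD; exact: integrableD.
by rewrite integralD_EFin// f2 g2 adde0.
Qed.

Lemma centeredZ (a : R) f : centered f -> centered (fun w => a * f w)%R.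
Proof.
move=> [f1 f2]; split.
  by rewrite /comp; under eq_fun do rewrite EFinM; exact: integrableZl.
by under eq_integral do rewrite EFinM; rewrite integralZl// f2 mule0.
Qed.

Lemma centered_sum (I : Type) (r : seq I) (F : I -> T -> R) :
  (forall i, centered (F i)) -> centered (fun w => \sum_(i <- r) F i w)%R.
Proof.
move=> cF; elim: r => [|i r IH].
  by under eq_fun do rewrite big_nil; exact: centered0.
by under eq_fun do rewrite big_cons; exact: centeredD.
Qed.

End Centered.

(** * Integrating out one variable *)

Section MomentStep.
Context d (T : measurableType d) (R : realType) (P : probability T R).
Variables (G G' : set (set T)) (J I : finType).
Variables (u : J -> T -> R) (v : J -> I -> T -> R) (phi : I -> T -> R).
Variables (q : nat) (K : R).
Hypotheses (Gm : G `<=` measurable) (G'm : G' `<=` measurable).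
Hypothesis GG' : independent_events P <<s G >> <<s G' >>.
Hypothesis aphi : forall t, adapted G' (phi t).
Hypothesis cphi : forall t, centered P (phi t).
Let rho w := \sum_t phi t w ^+ 2.
Hypothesis K1 : 1 <= K.
Hypothesis rhoK : (\int[P]_w (rho w)%:E <= K%:E)%E.
Hypothesis rhopK : (\int[P]_w (rho w ^+ q.+2)%:E <= K%:E)%E.
Hypothesis au : forall j, adapted G (u j).
Hypothesis av : forall j t, adapted G (v j t).

(** With z_j = sum_t phi_t v_(j,t): [U] = |u|^2, [V] = |v|^2, [W] = <u, z>, [S] = |z|^2, and [D] is
    the quantity whose power bounds the moment. *)
Let U w := \sum_j u j w ^+ 2.
Let V w := \sum_j \sum_t v j t w ^+ 2.
Let W w := \sum_t phi t w * \sum_j u j w * v j t w.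
Let S w := \sum_j (\sum_t phi t w * v j t w) ^+ 2.
Let c : R := step_cst q.+1.
Let D w := U w + c * K * V w.

Let U0 w : 0 <= U w. Proof. by apply: sumr_ge0 => j _; exact: sqr_ge0. Qed.
Let V0 w : 0 <= V w.
Proof. by apply: sumr_ge0 => j _; apply: sumr_ge0 => t _; exact: sqr_ge0. Qed.
Let rho0 w : 0 <= rho w. Proof. by apply: sumr_ge0 => j _; exact: sqr_ge0. Qed.
Let S0 w : 0 <= S w. Proof. by apply: sumr_ge0 => j _; exact: sqr_ge0. Qed.
Let c1 : 1 <= c. Proof. exact: step_cst_ge1. Qed.
Let cK1 : 1 <= c * K. Proof. by rewrite -[leLHS]mulr1 ler_pM. Qed.
Let D0 w : 0 <= D w.
Proof. by rewrite addr_ge0// mulr_ge0// (le_trans ler01). Qed.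

(** This separates the new variables from the past: [rho] is adapted to [G'] and [V] to [G], so
    expectations of the resulting products factor. *)
Let SrhoV w : S w <= rho w * V w.
Proof.
rewrite /S /V mulr_sumr ler_sum// => j _; exact: cauchy_schwarz_sum.
Qed.

Let WE w : W w = \sum_j u j w * \sum_t phi t w * v j t w.
Proof.
rewrite /W; under eq_bigr do rewrite mulr_sumr.
rewrite exchange_big/=; apply: eq_bigr => j _; rewrite mulr_sumr.
by apply: eq_bigr => t _; rewrite mulrCA.
Qed.

Let W2 w : W w ^+ 2 <= U w * (rho w * V w).
Proof.
rewrite WE; apply: le_trans (cauchy_schwarz_sum _ _) _.
exact: (ler_wpM2l (U0 w) (SrhoV w)).
Qed.

Let NE w : \sum_j (u j w + \sum_t phi t w * v j t w) ^+ 2 = U w + 2 * W w + S w.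
Proof.
rewrite WE /U /S mulr_sumr -!big_split/=; apply: eq_bigr => j _.
by rewrite sqrrD -mulr_natl mulrA.
Qed.

Let UVD w : U w + V w <= D w.
Proof. by rewrite /D lerD2l -[leLHS]mul1r ler_wpM2r. Qed.

Let pointwise w : (\sum_j (u j w + \sum_t phi t w * v j t w) ^+ 2) ^+ q.+2 <=
  (U w ^+ q.+2 + c * (U w ^+ q.+1 * V w * rho w + V w ^+ q.+2 * rho w ^+ q.+2))
  + q.+2%:R * 2 * (U w ^+ q.+1 * W w).
Proof.
have N0 : 0 <= U w + 2 * W w + S w.
  by rewrite -NE; apply: sumr_ge0 => j _; exact: sqr_ge0.
have SY : 0 <= S w <= rho w * V w by rewrite S0 SrhoV.
rewrite NE (le_trans (one_step q.+1 (U0 w) SY (W2 w) N0))//.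
by rewrite exprMn -/c le_eqVlt; apply/orP; left; apply/eqP; ring.
Qed.

Let aU : adapted G U.
Proof. by apply: measurable_sum => j; apply: measurable_funX; exact: au. Qed.

Let aV : adapted G V.
Proof.
apply: measurable_sum => j; apply: measurable_sum => t.
by apply: measurable_funX; exact: av.
Qed.

Let arho : adapted G' rho.
Proof. by apply: measurable_sum => t; apply: measurable_funX; exact: aphi. Qed.

Let mU := adapted_measurable Gm aU.
Let mV := adapted_measurable Gm aV.
Let mrho := adapted_measurable G'm arho.
Let mD : measurable_fun setT D.
Proof. by apply: measurable_funD => //; exact: measurable_funM. Qed.

Section FiniteRightHandSide.
Hypothesis finD : (\int[P]_w (D w ^+ q.+2)%:E < +oo)%E.

Let iD : P.-integrable setT (EFin \o (fun w => D w ^+ q.+2)).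
Proof.
apply/integrableP; split; first by apply/measurable_EFinP; exact: measurable_funX.
by under eq_integral do rewrite /= ger0_norm ?exprn_ge0//.
Qed.

(** Finiteness of the right-hand side gives an integrable majorant, needed for the linear term to
    have an integral at all. If the right-hand side is infinite, [moment_step] is trivial. *)
Let dominated (f : T -> R) : measurable_fun setT f ->
  (forall w, `|f w| <= D w ^+ q.+2) -> P.-integrable setT (EFin \o f).
Proof.
move=> mf fD; apply: le_integrable iD => //; first exact/measurable_EFinP.
by move=> w _ /=; rewrite lee_fin (le_trans (fD w))// ler_norm.
Qed.

Let abs_cross t w : `|\sum_j u j w * v j t w| <= U w + V w.
Proof.
rewrite (le_trans (ler_norm_sum _ _ _))// /U /V -big_split/= ler_sum// => j _.
rewrite normrM (bigD1 t)//= addrA -[leLHS]addr0 lerD//; last first.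
  by apply: sumr_ge0 => s _; exact: sqr_ge0.
rewrite -(real_normK (num_real (u j w))) -(real_normK (num_real (v j t w))).
by have := normr_ge0 (u j w); have := normr_ge0 (v j t w); nra.
Qed.

Let across t : adapted G (fun w => \sum_j u j w * v j t w).
Proof.
by apply: measurable_sum => j; apply: measurable_funM; [exact: au|exact: av].
Qed.

Let UD w : U w <= D w.
Proof. by rewrite (le_trans _ (UVD w))// lerDl. Qed.

(** [W] is linear in the [phi t], and each [phi t] is centered and independent of its coefficient,
    which is adapted to [G]. *)
Let centered_cross : centered P (fun w => q.+2%:R * 2 * (U w ^+ q.+1 * W w)).
Proof.
apply: centeredZ; rewrite /W.
under eq_fun do rewrite mulr_sumr.
apply: centered_sum => t; have [iphi phi0] := cphi t.
pose Y w := U w ^+ q.+1 * \sum_j u j w * v j t w.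
have aY : adapted G Y by apply: measurable_funM; [exact: measurable_funX|exact: across].
have iY : P.-integrable setT (EFin \o Y).
  apply: dominated; first exact: adapted_measurable aY.
  move=> w; rewrite normrM ger0_norm ?exprn_ge0// [leRHS]exprSr ler_pM ?exprn_ge0//.
    by rewrite lerXn2r ?nnegrE.
  exact: le_trans (abs_cross t w) (UVD w).
have [H1 H2] := indep_integralM_eq0 (adapted_indep GG' aY (aphi t)) iY iphi.
rewrite (_ : (fun w => _) = Y \* phi t); first by split=> //; exact: H2.
by apply/funext => w; rewrite /Y /= mulrCA [RHS]mulrC mulrA mulrC mulrA.
Qed.

Let M w := U w ^+ q.+2 + c * (U w ^+ q.+1 * V w * rho w + V w ^+ q.+2 * rho w ^+ q.+2).

(** Independence replaces [rho] and its top power by [K]: the first moment pairs with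
    [U ^+ q.+1 * V], the top moment with [V ^+ q.+2]. The result fits below a power of
    [U + c * K * V] by [exprD_ge_cross]. *)
Let int_M : (\int[P]_w (M w)%:E <= \int[P]_w (D w ^+ q.+2)%:E)%E.
Proof.
have mUV : measurable_fun setT (fun w => U w ^+ q.+1 * V w).
  by apply: measurable_funM => //; exact: measurable_funX.
have c0 : 0 <= c by exact: le_trans c1.
have K0 : 0 <= K by exact: le_trans K1.
have UV0 w : 0 <= U w ^+ q.+1 * V w by rewrite mulr_ge0// exprn_ge0.
have H1 : (\int[P]_w (U w ^+ q.+1 * V w * rho w)%:E
    <= K%:E * \int[P]_w (U w ^+ q.+1 * V w)%:E)%E.
  rewrite (ge0_indep_integralM (Y := fun w => U w ^+ q.+1 * V w))//; last first.
    apply: adapted_indep GG' _ arho.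
    by apply: measurable_funM => //; exact: measurable_funX.
  by rewrite muleC lee_wpmul2r// integral_ge0// => w _; rewrite lee_fin.
have H2 : (\int[P]_w (V w ^+ q.+2 * rho w ^+ q.+2)%:E
    <= K%:E * \int[P]_w (V w ^+ q.+2)%:E)%E.
  rewrite (ge0_indep_integralM (Y := fun w => V w ^+ q.+2)
    (Z := fun w => rho w ^+ q.+2)); last 5 first.
    - apply: adapted_indep GG' _ _; exact: measurable_funX.
    - exact: measurable_funX.
    - exact: measurable_funX.
    - by move=> w; rewrite exprn_ge0.
    - by move=> w; rewrite exprn_ge0.
  by rewrite muleC lee_wpmul2r// integral_ge0// => w _; rewrite lee_fin exprn_ge0.
pose A w := U w ^+ q.+2; pose B w := U w ^+ q.+1 * V w; pose C w := V w ^+ q.+2.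
have mA : measurable_fun setT A by exact: measurable_funX.
have mC : measurable_fun setT C by exact: measurable_funX.
have mr : measurable_fun setT (fun w => rho w ^+ q.+2) by exact: measurable_funX.
have B0 w : 0 <= B w by exact: UV0.
have mB : measurable_fun setT B by [].
have cK0 : 0 <= c * K by rewrite mulr_ge0.
have Br0 w : 0 <= B w * rho w by rewrite mulr_ge0.
have Cr0 w : 0 <= V w ^+ q.+2 * rho w ^+ q.+2 by rewrite mulr_ge0 ?exprn_ge0.
have A0 w : 0 <= A w by rewrite exprn_ge0.
have C0 w : 0 <= C w by rewrite exprn_ge0.
have r0 w : 0 <= rho w ^+ q.+2 by rewrite exprn_ge0.
apply: (@le_trans _ _ (\int[P]_w (A w + (c * K) * (B w + C w))%:E)%E); last first.
  apply: ge0_le_integral => //.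
  - by move=> w _; rewrite lee_fin addr_ge0// mulr_ge0// addr_ge0.
  - apply/measurable_EFinP; apply: measurable_funD => //; apply: measurable_funM => //.
    exact: measurable_funD.
  - by apply/measurable_EFinP; exact: measurable_funX.
  - move=> w _; rewrite lee_fin.
    have cKV0 : 0 <= c * K * V w by rewrite mulr_ge0// (le_trans ler01).
    rewrite (le_trans _ (exprD_ge_cross (p := q.+2) _ (U0 w) cKV0))//=.
    rewrite lerD2l mulrDr lerD//; first by rewrite /B mulrCA.
    rewrite /C exprMn; apply: ler_wpM2r; first by rewrite exprn_ge0.
    (* Since [c * K >= 1], one factor [c * K] is at most its power. *)
    by rewrite [leRHS]exprS ler_peMr// exprn_ege1.
rewrite -[leLHS]/(\int[P]_w ((A w)%:E
  + c%:E * ((B w * rho w)%:E + (V w ^+ q.+2 * rho w ^+ q.+2)%:E)))%E.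
rewrite ge0_integralD//; last 4 first.
- by move=> w _; rewrite lee_fin.
- by apply/measurable_EFinP.
- by move=> w _; rewrite -EFinD -EFinM lee_fin; apply: mulr_ge0 => //; exact: addr_ge0.
- apply: emeasurable_funM => //; apply: emeasurable_funD.
    by apply/measurable_EFinP; exact: measurable_funM.
  by apply/measurable_EFinP; exact: measurable_funM.
rewrite -[leRHS]/(\int[P]_w ((A w)%:E + (c * K)%:E * ((B w)%:E + (C w)%:E)))%E.
rewrite [leRHS]ge0_integralD//; last 4 first.
- by move=> w _; rewrite lee_fin.
- by apply/measurable_EFinP.
- by move=> w _; rewrite -EFinD -EFinM lee_fin; apply: mulr_ge0 => //; exact: addr_ge0.
- apply: emeasurable_funM => //; apply: emeasurable_funD; exact/measurable_EFinP.
rewrite leeD2l//.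
rewrite ge0_integralZl//; last 2 first.
- apply: emeasurable_funD; apply/measurable_EFinP; exact: measurable_funM.
- by move=> w _; rewrite -EFinD lee_fin; exact: addr_ge0.
rewrite ge0_integralD//; last 4 first.
- by move=> w _; rewrite lee_fin.
- by apply/measurable_EFinP; exact: measurable_funM.
- by move=> w _; rewrite lee_fin.
- by apply/measurable_EFinP; exact: measurable_funM.
rewrite [leRHS]ge0_integralZl//; last 2 first.
- by apply: emeasurable_funD; apply/measurable_EFinP.
- by move=> w _; rewrite -EFinD lee_fin; exact: addr_ge0.
rewrite [X in (_ <= _ * X)%E]ge0_integralD//; last 4 first.
- by move=> w _; rewrite lee_fin.
- by apply/measurable_EFinP.
- by move=> w _; rewrite lee_fin.
- by apply/measurable_EFinP.
rewrite EFinM -muleA lee_wpmul2l ?lee_fin//.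
rewrite ge0_muleDr ?integral_ge0//; last 2 first.
- by move=> w _; rewrite lee_fin.
- by move=> w _; rewrite lee_fin.
exact: leeD.
Qed.

Let mN : measurable_fun setT
  (fun w => (\sum_j (u j w + \sum_t phi t w * v j t w) ^+ 2) ^+ q.+2).
Proof.
apply: measurable_funX; apply: measurable_sum => j; apply: measurable_funX.
apply: measurable_funD; first exact: adapted_measurable (au j).
apply: measurable_sum => t; apply: measurable_funM.
  exact: adapted_measurable (aphi t).
exact: adapted_measurable (av j t).
Qed.

Lemma finite_moment_step :
  (\int[P]_w ((\sum_j (u j w + \sum_t phi t w * v j t w) ^+ 2) ^+ q.+2)%:E
   <= \int[P]_w (D w ^+ q.+2)%:E)%E.
Proof.
have M0 w : 0 <= M w.
  rewrite addr_ge0 ?exprn_ge0// mulr_ge0//; first exact: le_trans c1.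
  by rewrite addr_ge0// mulr_ge0 ?exprn_ge0// mulr_ge0 ?exprn_ge0.
have mM : measurable_fun setT M.
  apply: measurable_funD; first exact: measurable_funX.
  apply: measurable_funM => //; apply: measurable_funD.
    by apply: measurable_funM => //; apply: measurable_funM => //; exact: measurable_funX.
  by apply: measurable_funM; exact: measurable_funX.
have iM : P.-integrable setT (EFin \o M).
  apply/integrableP; split; first exact/measurable_EFinP.
  under eq_integral do rewrite /= ger0_norm//.
  exact: le_lt_trans int_M finD.
have [iW W00] := centered_cross.
(* The zero integral of the linear term is added on the right, to match [pointwise]. *)
apply: (le_trans _ int_M); rewrite -[leRHS]adde0 -W00 -integralD_EFin//.
apply: ge0_le_integral => //.
- by move=> w _; rewrite lee_fin exprn_ge0// sumr_ge0// => j _; exact: sqr_ge0.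
- exact/measurable_EFinP.
- apply/measurable_EFinP; apply: measurable_funD => //.
  by apply/measurable_EFinP; exact: measurable_int iW.
- by move=> w _; rewrite lee_fin; exact: pointwise.
Qed.

End FiniteRightHandSide.

Lemma moment_step :
  (\int[P]_w ((\sum_j (u j w + \sum_t phi t w * v j t w) ^+ 2) ^+ q.+2)%:E
   <= \int[P]_w ((\sum_j (u j w ^+ 2
       + step_cst q.+1 * K * \sum_t v j t w ^+ 2)) ^+ q.+2)%:E)%E.
Proof.
under [leRHS]eq_integral => w _.
  rewrite big_split/= -mulr_sumr -/(U w) -/(V w) -/c -/(D w).
  over.
have [/finite_moment_step//|] := ltP (\int[P]_w (D w ^+ q.+2)%:E)%E +oo%E.
by rewrite leye_eq => /eqP ->; rewrite leey.
Qed.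

End MomentStep.

(** * Polynomials in successive variables and their moments *)

Section Chaos.
Context d (T : measurableType d) (R : realType).
Variables (I : finType) (phi : nat -> I -> T -> R) (C : R).

(* A chaos of level k is a polynomial f + sum_t phi_(k-1),t * g_t in the random
   variables phi_i,t with i < k, where f and the g_t are chaoses of level k - 1;
   the coefficients are random variables. Its weight is the sum of the squared
   coefficients, with one factor C for each index i occurring in the monomial. *)
Fixpoint chaos (k : nat) : Type :=
  if k is k'.+1 then (chaos k' * (I -> chaos k'))%type else T -> R.

Fixpoint chaos_eval k : chaos k -> T -> R :=
  if k is k'.+1 then fun c w =>
    chaos_eval c.1 w + \sum_t phi k' t w * chaos_eval (c.2 t) w
  else fun c w => c w.

Fixpoint chaos_weight k : chaos k -> T -> R :=
  if k is k'.+1 then fun c w =>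
    chaos_weight c.1 w + C * \sum_t chaos_weight (c.2 t) w
  else fun c w => c w ^+ 2.

Fixpoint chaos_adapted (G : set (set T)) k : chaos k -> Prop :=
  if k is k'.+1 then fun c =>
    chaos_adapted G c.1 /\ forall t, chaos_adapted G (c.2 t)
  else fun c => adapted G c.

Fixpoint const_chaos (f : T -> R) k : chaos k :=
  if k is k'.+1 then (const_chaos f k', fun=> const_chaos (fun=> 0) k') else f.

Fixpoint affine_chaos (f : T -> R) (g : nat -> I -> T -> R) k : chaos k :=
  if k is k'.+1 then
    (affine_chaos f g k', fun t => const_chaos (g k' t) k')
  else f.

(** Every product of two variables is recorded under its larger index, so that the cofactor of
    [phi i t] is affine in earlier variables only. *)
Fixpoint quadratic_chaos (b : nat -> I -> T -> R)
    (L : nat -> I -> nat -> I -> T -> R) k : chaos k :=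
  if k is k'.+1 then
    (quadratic_chaos b L k', fun t => affine_chaos (b k' t) (L k' t) k')
  else fun=> 0.

Lemma const_chaos_eval f k w : chaos_eval (const_chaos f k) w = f w.
Proof.
elim: k f => //= k IH f; rewrite !IH big1 ?addr0// => t _.
by rewrite mulr0.
Qed.

Lemma const_chaos_weight f k w : chaos_weight (const_chaos f k) w = f w ^+ 2.
Proof.
elim: k f => //= k IH f; rewrite !IH big1 ?mulr0 ?addr0// => t _.
by rewrite expr0n.
Qed.

Lemma affine_chaos_eval f g k w : chaos_eval (affine_chaos f g k) w
  = f w + \sum_(i < k) \sum_t phi i t w * g i t w.
Proof.
elim: k => /= [|k IH]; first by rewrite big_ord0 addr0.
rewrite IH big_ord_recr /= !addrA; congr (_ + _).
by apply: eq_bigr => t _; rewrite const_chaos_eval.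
Qed.

Lemma affine_chaos_weight f g k w : chaos_weight (affine_chaos f g k) w
  = f w ^+ 2 + C * \sum_(i < k) \sum_t g i t w ^+ 2.
Proof.
elim: k => /= [|k IH]; first by rewrite big_ord0 mulr0 addr0.
rewrite IH big_ord_recr /= mulrDr !addrA; congr (_ + C * _).
by apply: eq_bigr => t _; rewrite const_chaos_weight.
Qed.

Lemma quadratic_chaos_eval b L k w : chaos_eval (quadratic_chaos b L k) w
  = \sum_(i < k) \sum_t phi i t w *
      (b i t w + \sum_(i' < i) \sum_t' phi i' t' w * L i t i' t' w).
Proof.
elim: k => /= [|k IH]; first by rewrite big_ord0.
rewrite IH big_ord_recr /=; congr (_ + _).
by apply: eq_bigr => t _; rewrite affine_chaos_eval.
Qed.

Lemma quadratic_chaos_weight b L k w : chaos_weight (quadratic_chaos b L k) w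
  = C * \sum_(i < k) \sum_t
      (b i t w ^+ 2 + C * \sum_(i' < i) \sum_t' L i t i' t' w ^+ 2).
Proof.
elim: k => /= [|k IH]; first by rewrite big_ord0 mulr0 expr0n.
rewrite IH big_ord_recr /= mulrDr; congr (_ + C * _).
by apply: eq_bigr => t _; rewrite affine_chaos_weight.
Qed.

Lemma adapted_cst G (r : R) : @adapted _ T R G (fun=> r).
Proof. exact: measurable_cst. Qed.

Lemma chaos_weight_adapted G k (c : chaos k) : chaos_adapted G c ->
  adapted G (chaos_weight c).
Proof.
elim: k c => [|k IH] c /=; first by move=> ac; exact: measurable_funX.
move=> [a1 a2]; apply: measurable_funD; first exact: IH.
apply: measurable_funM; first exact: adapted_cst.
by apply: measurable_sum => t; apply: IH.
Qed.

Lemma const_chaos_adapted G f k : adapted G f ->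
  chaos_adapted G (const_chaos f k).
Proof.
elim: k f => //= k IH f af; split; first exact: IH.
by move=> t; apply: IH; exact: adapted_cst.
Qed.

Lemma affine_chaos_adapted G f g k : adapted G f ->
  (forall i t, adapted G (g i t)) -> chaos_adapted G (affine_chaos f g k).
Proof.
move=> af ag; elim: k => //= k IH; split=> // t; exact: const_chaos_adapted.
Qed.

Lemma quadratic_chaos_adapted G b L k : (forall i t, adapted G (b i t)) ->
  (forall i t i' t', adapted G (L i t i' t')) ->
  chaos_adapted G (quadratic_chaos b L k).
Proof.
move=> ab aL; elim: k => [|k IH /=]; first exact: adapted_cst.
by split=> // t; apply: affine_chaos_adapted.
Qed.

End Chaos.

Section ChaosMoment.
Context d (T : measurableType d) (R : realType) (P : probability T R).
Variables (I : finType) (phi : nat -> I -> T -> R) (n q : nat) (K : R).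
Variables G G' : nat -> set (set T).
Hypothesis Gm : forall k, G k `<=` measurable.
Hypothesis G'm : forall k, G' k `<=` measurable.
Hypothesis GG : forall k, (k < n)%N -> G k `<=` <<s G k.+1 >>.
Hypothesis G'G : forall k, (k < n)%N -> G' k `<=` <<s G k.+1 >>.
Hypothesis indepG : forall k, (k < n)%N ->
  independent_events P <<s G k >> <<s G' k >>.
Hypothesis aphi : forall k t, (k < n)%N -> adapted (G' k) (phi k t).
Hypothesis cphi : forall k t, (k < n)%N -> centered P (phi k t).
Hypothesis K1 : 1 <= K.
Hypothesis phiK : forall k, (k < n)%N ->
  (\int[P]_w (\sum_t phi k t w ^+ 2)%:E <= K%:E)%E.
Hypothesis phipK : forall k, (k < n)%N ->
  (\int[P]_w ((\sum_t phi k t w ^+ 2) ^+ q.+2)%:E <= K%:E)%E.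

Let C : R := step_cst q.+1 * K.

Lemma chaos_eval_adapted k (c : chaos T R I k) : (k <= n)%N ->
  chaos_adapted (G 0%N) c -> adapted (G k) (chaos_eval phi c).
Proof.
elim: k c => [|k IH] c //= kn [a1 a2].
apply: measurable_funD.
  by apply: adapted_sub (IH _ (ltnW kn) a1); exact: GG.
apply: measurable_sum => t; apply: measurable_funM.
  by apply: adapted_sub (aphi t kn); exact: G'G.
by apply: adapted_sub (IH _ (ltnW kn) (a2 t)); exact: GG.
Qed.

(* Integrating out the last variable by [moment_step] turns the sum over J of the
   squares of the chaoses into a sum over J + J * I of chaoses of lower level. *)
Theorem chaos_moment k (J : finType) (l : J -> R) (c : J -> chaos T R I k) :
  (k <= n)%N -> (forall j, 0 <= l j) -> (forall j, chaos_adapted (G 0%N) (c j)) ->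
  (\int[P]_w ((\sum_j l j * chaos_eval phi (c j) w ^+ 2) ^+ q.+2)%:E
   <= \int[P]_w ((\sum_j l j * chaos_weight C (c j) w) ^+ q.+2)%:E)%E.
Proof.
elim: k J l c => [|k IH] J l c kn l0 ca //=.
have C0 : 0 <= C.
  by rewrite mulr_ge0// (le_trans ler01)//; exact: step_cst_ge1.
(* The step multiplies the coefficients of the last variable by [C]; the weights [l] are there to
   carry this factor through the induction. *)
pose l' (j : J + J * I) := match j with inl j => l j | inr (j, _) => C * l j end.
pose c' (j : J + J * I) :=
  match j with inl j => (c j).1 | inr (j, t) => (c j).2 t end.
have l'0 j : 0 <= l' j by case: j => [j|[j t]] //=; rewrite mulr_ge0.
have ca' j : chaos_adapted (G 0%N) (c' j).
  by case: j => [j|[j t]]; have [a1 a2] := ca j; [exact: a1|exact: a2].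
(* The same regrouping serves the weights and the squared values, hence the arbitrary [F]. *)
have sumE (F : forall k, chaos T R I k -> R) :
    \sum_j l' j * F k (c' j)
    = \sum_j l j * (F k (c j).1 + C * \sum_t F k ((c j).2 t)).
  rewrite big_sumType /=.
  transitivity (\sum_j l j * F k (c j).1
    + \sum_j \sum_t C * l j * F k ((c j).2 t)).
    by congr (_ + _); rewrite pair_bigA; apply: eq_bigr => -[j t] _.
  rewrite -big_split/=; apply: eq_bigr => j _.
  by rewrite mulrDr -mulr_sumr mulrA [C * l j]mulrC.
under [leRHS]eq_integral => w _.
  rewrite -(sumE (fun k c => chaos_weight C c w)); over.
apply: le_trans (IH _ _ _ (ltnW kn) l'0 ca').
under [leRHS]eq_integral => w _.
  rewrite (sumE (fun k c => chaos_eval phi c w ^+ 2)).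
  over.
(* [moment_step] has no weights, so they enter as square roots in the coefficients. *)
pose u j w := Num.sqrt (l j) * chaos_eval phi (c j).1 w.
pose v j t w := Num.sqrt (l j) * chaos_eval phi ((c j).2 t) w.
have := @moment_step _ _ _ P (G k) (G' k) J I u v (phi k) q K (Gm (k:=k))
  (G'm (k:=k)) (indepG kn) (fun t => aphi t kn) (fun t => cphi t kn) K1
  (phiK kn) (phipK kn).
move=> H; apply: (le_trans (y := _) _ (le_trans (H _ _) _)).
- rewrite le_eqVlt; apply/orP; left; apply/eqP; apply: eq_integral => w _.
  congr ((_ ^+ _)%:E); apply: eq_bigr => j _.
  rewrite /u /v -[l j in LHS]sqr_sqrtr// -exprMn mulrDr; congr ((_ + _) ^+ _).
  by rewrite mulr_sumr; apply: eq_bigr => t _; rewrite mulrCA.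
- move=> j; apply: measurable_funM; first exact: adapted_cst.
  by apply: chaos_eval_adapted (ltnW kn) _; have [a1 _] := ca j; exact: a1.
- move=> j t; apply: measurable_funM; first exact: adapted_cst.
  by apply: chaos_eval_adapted (ltnW kn) _; have [_ a2] := ca j; exact: a2.
- rewrite le_eqVlt; apply/orP; left; apply/eqP; apply: eq_integral => w _.
  congr ((_ ^+ _)%:E); apply: eq_bigr => j _.
  rewrite mulrDr /u exprMn sqr_sqrtr//; congr (_ + _).
  rewrite [RHS]mulrCA; congr (_ * _); rewrite mulr_sumr; apply: eq_bigr => t _.
  by rewrite /v exprMn sqr_sqrtr.
Qed.

End ChaosMoment.

Lemma independent_eventsC d (T : measurableType d) (R : realType)
    (P : probability T R) G H :
  independent_events P G H -> independent_events P H G.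
Proof. by move=> GH E F HE GF; rewrite setIC muleC; exact: GH. Qed.

(** * The filtration generated by the coefficients and the successive variables *)

Section ComplexBorel.
Context {R : realType}.
Implicit Types B : set R[i].

Lemma complex_borelT : complex_borel (setT : set R[i]).
Proof. exact: measurableT. Qed.

Lemma complex_borelI B B' :
  complex_borel B -> complex_borel B' -> complex_borel (B `&` B').
Proof. exact: measurableI. Qed.

Lemma complex_borel_Re (C : set R) : measurable C ->
  complex_borel [set z : R[i] | C (complex.Re z)].
Proof.
move=> mC; rewrite /complex_borel /=.
have := measurable_fst (T1 := measurableTypeR R) (T2 := measurableTypeR R).
by move/(_ measurableT C mC); rewrite setTI.
Qed.

Lemma complex_borel_Im (C : set R) : measurable C ->
  complex_borel [set z : R[i] | C (complex.Im z)].
Proof.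
move=> mC; rewrite /complex_borel /=.
have := measurable_snd (T1 := measurableTypeR R) (T2 := measurableTypeR R).
by move/(_ measurableT C mC); rewrite setTI.
Qed.

End ComplexBorel.

Section Filtration.
Context d (T : measurableType d) (R : realType) (P : probability T R).
Variables (I : finType) (J : Type) (X : I -> T -> R[i]) (Y : J -> T -> R[i]).
Variable rank : I -> nat.
Hypothesis rank_inj : injective rank.
Hypothesis X_rv : forall i, complex_rv (X i).
Hypothesis Y_rv : forall j, complex_rv (Y j).
Hypothesis X_indep : mutually_independent P X.
Hypothesis XY_indep : independent_families P X Y.

(* [past k] is a pi-system generating the sigma-algebra of Y and of the X i with
   rank i < k; [present k] consists of the events of the X i with rank i = k. *)
Definition past k : set (set T) := [set E | exists F, exists B : I -> set R[i],
  [/\ sigma_generated Y F, forall i, complex_borel (B i),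
      forall i, (k <= rank i)%N -> B i = setT &
      E = F `&` \bigcap_i (X i @^-1` B i)]].

Definition present k : set (set T) := [set E | exists i, exists B,
  [/\ rank i = k, complex_borel B & E = X i @^-1` B]].

Lemma sigma_generated_measurable F : sigma_generated Y F -> measurable F.
Proof.
apply: smallest_sub; first exact: sigma_algebra_measurable.
by move=> _ [j [B [mB ->]]]; exact: Y_rv.
Qed.

Lemma present_measurable k : present k `<=` measurable.
Proof. by move=> _ [i [B [_ mB ->]]]; exact: X_rv. Qed.

Lemma bigcap_preimage_generated (B : I -> set R[i]) :
  (forall i, complex_borel (B i)) ->
  sigma_generated X (\bigcap_i (X i @^-1` B i)).
Proof.
move=> mB; rewrite /sigma_generated; set G := [set _ | _].
have := @fin_bigcap_measurable _ (g_sigma_algebraType G) I setT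
  (fun i => X i @^-1` B i) (@finite_finset I setT).
apply=> i _; apply: sub_gen_smallest.
by exists i, (B i).
Qed.

Lemma past_measurable k : past k `<=` measurable.
Proof.
move=> _ [F [B [sF mB _ ->]]]; apply: measurableI.
  exact: sigma_generated_measurable.
apply: fin_bigcap_measurable => [|i _]; first exact: finite_finset.
exact: X_rv.
Qed.

Lemma probability_past F (B : I -> set R[i]) : sigma_generated Y F ->
  (forall i, complex_borel (B i)) ->
  (P (F `&` \bigcap_i (X i @^-1` B i)) = P F * \prod_i P (X i @^-1` B i))%E.
Proof.
move=> sF mB; rewrite setIC XY_indep//; last exact: bigcap_preimage_generated.
by rewrite muleC X_indep.
Qed.

Let bigcap_preimageT : \bigcap_i (X i @^-1` setT) = setT.
Proof. by rewrite -subTset => w _ i. Qed.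

Lemma past_setT k : past k setT.
Proof.
exists setT, (fun=> setT); split => //.
- have := @measurableT _ (g_sigma_algebraType
    [set E | exists j B, complex_borel B /\ E = Y j @^-1` B]).
  exact.
- by move=> i; exact: complex_borelT.
- by rewrite setTI bigcap_preimageT.
Qed.

Lemma past_setI k : setI_closed (past k).
Proof.
move=> _ _ [F [B [sF mB Bk ->]]] [F' [B' [sF' mB' Bk' ->]]].
exists (F `&` F'), (fun i => B i `&` B' i); split => //.
- have := @measurableI _ (g_sigma_algebraType
    [set E | exists j B, complex_borel B /\ E = Y j @^-1` B]) F F'.
  exact.
- by move=> i; exact: complex_borelI.
- by move=> i ki; rewrite Bk// Bk'// setTI.
- rewrite setIACA; congr (_ `&` _); apply/seteqP; split=> [w [h h'] i _|w h].
    by split; [exact: h|exact: h'].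
  by split=> i _; have [] := h i Logic.I.
Qed.

Lemma past_mono k : past k `<=` <<s past k.+1 >>.
Proof.
move=> _ [F [B [sF mB Bk ->]]]; apply: sub_gen_smallest.
by exists F, B; split=> // i /ltnW /Bk.
Qed.

Let upd (B : I -> set R[i]) i B' j := if j == i then B' else B j.

Lemma bigcap_upd B i B' : B i = setT ->
  \bigcap_j (X j @^-1` upd B i B' j)
  = (\bigcap_j (X j @^-1` B j)) `&` X i @^-1` B'.
Proof.
move=> Bi; apply/seteqP; split=> [w h|w [h h'] j _].
  split=> [j _|]; last by have := h i Logic.I; rewrite /upd /= eqxx.
  have [->|ji] := eqVneq j i; first by rewrite Bi.
  by have := h j Logic.I; rewrite /upd /= (negbTE ji).
rewrite /upd /=; case: eqVneq => [->//|_]; exact: h.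
Qed.

Lemma upd_borel B i B' : (forall j, complex_borel (B j)) -> complex_borel B' ->
  forall j, complex_borel (upd B i B' j).
Proof. by move=> mB mB' j; rewrite /upd; case: eqP. Qed.

Lemma present_past k : present k `<=` <<s past k.+1 >>.
Proof.
move=> _ [i [B [ik mB ->]]]; apply: sub_gen_smallest.
exists setT, (upd (fun=> setT) i B); split.
- have := @measurableT _ (g_sigma_algebraType
    [set E | exists j B, complex_borel B /\ E = Y j @^-1` B]).
  exact.
- by apply: upd_borel => // j; exact: complex_borelT.
- by move=> j kj; rewrite /upd; case: eqP => // ji; rewrite ji ik ltnn in kj.
- by rewrite bigcap_upd// setTI bigcap_preimageT setTI.
Qed.

(** A past event leaves the variable of rank k unconstrained, so an event of that variable fits into
    the free slot by [upd]; both sides then factor by [probability_past]. *)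
Lemma past_present_indep k : independent_events P (past k) (present k).
Proof.
move=> _ _ [F [B [sF mB Bk ->]]] [i [B' [ik mB' ->]]].
have Bi : B i = setT by apply: Bk; rewrite ik.
rewrite -setIA -bigcap_upd// probability_past//; last exact: upd_borel.
rewrite probability_past// (bigD1 i)//= [in RHS](bigD1 i)//= {1}/upd eqxx.
rewrite Bi preimage_setT probability_setT mul1e -muleA; congr (_ * _)%E.
rewrite muleC; congr (_ * _)%E; apply: eq_bigr => j ji.
by rewrite /upd (negbTE ji).
Qed.

(** The pi-system argument is applied to one side at a time, exchanging the roles by symmetry.
    Injectivity of [rank] makes [present] a pi-system: its events concern a single variable. *)
Lemma filtration_indep i : independent_events P
  <<s past (rank i) >> <<s present (rank i) >>.
Proof.
have pm := @present_measurable (rank i); have qm := @past_measurable (rank i).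
have sm : <<s past (rank i) >> `<=` measurable.
  by apply: smallest_sub => //; exact: sigma_algebra_measurable.
apply: independent_eventsC; apply: independent_events_sigmal => //.
- by exists i, setT; split=> //; exact: complex_borelT.
- move=> _ _ [j [B [jk mB ->]]] [j' [B' [jk' mB' ->]]].
  exists j, (B `&` B'); split => //; first exact: complex_borelI.
  by rewrite (rank_inj (etrans jk (esym jk'))).
- apply: independent_eventsC; apply: independent_events_sigmal => //.
  + exact: past_setT.
  + exact: past_setI.
  + exact: past_present_indep.
Qed.

Lemma adapted_Re_present i :
  adapted (present (rank i)) (fun w => complex.Re (X i w)).
Proof.
move=> _ C mC; rewrite setTI; apply: sub_gen_smallest.
by exists i, [set z | C (complex.Re z)]; split=> //; exact: complex_borel_Re.
Qed.

Lemma adapted_Im_present i :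
  adapted (present (rank i)) (fun w => complex.Im (X i w)).
Proof.
move=> _ C mC; rewrite setTI; apply: sub_gen_smallest.
by exists i, [set z | C (complex.Im z)]; split=> //; exact: complex_borel_Im.
Qed.

Let generated_past k F : sigma_generated Y F -> past k F.
Proof.
move=> sF; exists F, (fun=> setT); split => //.
  by move=> i; exact: complex_borelT.
by rewrite bigcap_preimageT setIT.
Qed.

Lemma adapted_Re_past k j : adapted (past k) (fun w => complex.Re (Y j w)).
Proof.
move=> _ C mC; rewrite setTI; apply: sub_gen_smallest; apply: generated_past.
apply: sub_gen_smallest.
by exists j, [set z | C (complex.Re z)]; split=> //; exact: complex_borel_Re.
Qed.

Lemma adapted_Im_past k j : adapted (past k) (fun w => complex.Im (Y j w)).
Proof.
move=> _ C mC; rewrite setTI; apply: sub_gen_smallest; apply: generated_past.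
apply: sub_gen_smallest.
by exists j, [set z | C (complex.Im z)]; split=> //; exact: complex_borel_Im.
Qed.

End Filtration.

(** * Spectral norm, Frobenius norm and the entries of the deviation *)

Section SpectralFrobenius.
Context {R : realType}.
Implicit Types z : R[i].

Lemma normc_sqr z : Normc.normc z ^+ 2 = complex.Re z ^+ 2 + complex.Im z ^+ 2.
Proof. by case: z => a b; rewrite /= sqr_sqrtr// addr_ge0 ?sqr_ge0. Qed.

Lemma normc_ge0 z : 0 <= Normc.normc z.
Proof. by case: z => a b; exact: sqrtr_ge0. Qed.

Lemma ler_normc_sum (J : finType) (F : J -> R[i]) :
  Normc.normc (\sum_j F j) <= \sum_j Normc.normc (F j).
Proof.
elim/big_ind2 : _ => //; first by rewrite Normc.normc0.
move=> z1 r1 z2 r2 h1 h2; apply: le_trans (lerD h1 h2); exact: le_normcD.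
Qed.

Definition frobenius2 m n (A : 'M[R[i]]_(m, n)) : R :=
  \sum_i \sum_j Normc.normc (A i j) ^+ 2.

Lemma frobenius2_ge0 m n (A : 'M[R[i]]_(m, n)) : 0 <= frobenius2 A.
Proof. by apply: sumr_ge0 => i _; apply: sumr_ge0 => j _; exact: sqr_ge0. Qed.

Lemma cnorm2_ge0 n (v : 'cV[R[i]]_n) : 0 <= cnorm2 v.
Proof. exact: sqrtr_ge0. Qed.

Lemma cnorm2_sqr n (v : 'cV[R[i]]_n) :
  cnorm2 v ^+ 2 = \sum_i Normc.normc (v i 0) ^+ 2.
Proof. by rewrite sqr_sqrtr// sumr_ge0// => i _; exact: sqr_ge0. Qed.

Lemma cnorm2_mulmx m n (A : 'M[R[i]]_(m, n)) (v : 'cV[R[i]]_n) :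
  cnorm2 v <= 1 -> cnorm2 (A *m v) <= Num.sqrt (frobenius2 A).
Proof.
move=> v1; apply: ler_wsqrtr; apply: ler_sum => i _; rewrite mxE.
have v1' : \sum_j Normc.normc (v j 0) ^+ 2 <= 1.
  by rewrite -cnorm2_sqr exprn_ile1// cnorm2_ge0.
apply: (@le_trans _ _ ((\sum_j Normc.normc (A i j) * Normc.normc (v j 0)) ^+ 2)).
  rewrite lerXn2r ?nnegrE ?normc_ge0//.
    by apply: sumr_ge0 => j _; rewrite mulr_ge0 ?normc_ge0.
  apply: le_trans (ler_normc_sum _) _.
  by apply: ler_sum => j _; rewrite Normc.normcM.
apply: le_trans (cauchy_schwarz_sum _ _) _.
by rewrite ler_piMr// sumr_ge0// => j _; exact: sqr_ge0.
Qed.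

Lemma spectral_norm_le m n (A : 'M[R[i]]_(m, n)) :
  spectral_norm A <= Num.sqrt (frobenius2 A).
Proof.
apply: ge_sup => [|_ [v /= v1 <-]]; last exact: cnorm2_mulmx.
exists (cnorm2 (A *m 0)), 0 => //=.
rewrite /cnorm2 big1 ?sqrtr0// => i _.
by rewrite mxE Normc.normc0 expr0n.
Qed.

Lemma cnorm2_le_spectral_norm m n (A : 'M[R[i]]_(m, n)) (v : 'cV[R[i]]_n) :
  cnorm2 v <= 1 -> cnorm2 (A *m v) <= spectral_norm A.
Proof.
move=> v1; apply: ub_le_sup; last by exists v.
by exists (Num.sqrt (frobenius2 A)) => _ [u /= u1 <-]; exact: cnorm2_mulmx.
Qed.

Lemma spectral_norm_ge0 m n (A : 'M[R[i]]_(m, n)) : 0 <= spectral_norm A.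
Proof.
apply: le_trans (cnorm2_le_spectral_norm A (v := 0) _); first exact: cnorm2_ge0.
by rewrite /cnorm2 big1 ?sqrtr0// => i _; rewrite mxE Normc.normc0 expr0n.
Qed.

(** Each column is the image of a unit vector, so its norm is at most the spectral norm. For A there
    are L M columns, which is the origin of the factor L M in the moment bound. *)
Lemma frobenius2_le m n (A : 'M[R[i]]_(m, n)) :
  frobenius2 A <= n%:R * spectral_norm A ^+ 2.
Proof.
rewrite /frobenius2 exchange_big/=.
rewrite (_ : n%:R * _ = \sum_(j < n) spectral_norm A ^+ 2); last first.
  by rewrite sumr_const card_ord mulr_natl.
apply: ler_sum => j _.
have d1 : cnorm2 (delta_mx j 0 : 'cV[R[i]]_n) <= 1.
  rewrite /cnorm2 (bigD1 j)//= big1 => [|i ij].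
    by rewrite mxE !eqxx Normc.normc1 expr1n addr0 sqrtr1.
  by rewrite mxE (negbTE ij) Normc.normc0 expr0n.
rewrite (eq_bigr (fun i => Normc.normc ((A *m delta_mx j 0 : 'cV__) i 0) ^+ 2)).
  rewrite -cnorm2_sqr lerXn2r ?nnegrE ?cnorm2_ge0 ?spectral_norm_ge0//.
  by apply: cnorm2_le_spectral_norm.
by move=> i _; rewrite -colE mxE.
Qed.

End SpectralFrobenius.

Section Deviation.
Context {R : realType}.

Definition deviation L M (x : 'cV[R[i]]_L) (A : 'M[R[i]]_(L * M)) : 'M[R[i]]_M :=
  \matrix_(a, b) (\sum_i \sum_j (x i 0)^* *
      blk A i j a b * x j 0 - \sum_i blk A i i a b).

Lemma kron_idE L M (x : 'cV[R[i]]_L) i c b :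
  kron_id M x (mxtens.mxtens_index (i, c)) b = x i 0 * (c == b)%:R.
Proof.
rewrite /kron_id castmxE /= cast_ord_id.
rewrite (_ : cast_ord _ b = mxtens.mxtens_index (ord0 : 'I_1, b)); last first.
  by apply/val_inj; rewrite /= mul0n.
by rewrite mxtens.tensmxE mxE.
Qed.

Lemma sum_mxtens_index (V : nmodType) L M (F : 'I_(L * M) -> V) :
  \sum_k F k = \sum_i \sum_c F (mxtens.mxtens_index (i, c)).
Proof.
rewrite pair_bigA /=.
rewrite (reindex (@mxtens.mxtens_index L M)); first by apply: eq_bigr => -[].
by exists (@mxtens.mxtens_unindex L M) => k _;
  [exact: mxtens.mxtens_indexK|exact: mxtens.mxtens_unindexK].
Qed.

(** A column of [kron_id] has at most one nonzero entry in each block, so the sums over positions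
    inside the blocks collapse. *)
Lemma deviationE L M (x : 'cV[R[i]]_L) (A : 'M[R[i]]_(L * M)) :
  ((kron_id M x) ^t* *m A *m kron_id M x - blktr A)%sesqui = deviation x A.
Proof.
apply/matrixP => a b; rewrite !mxE; congr (_ - _); last first.
  by rewrite /blktr summxE; apply: eq_bigr => i _; rewrite mxE.
rewrite sum_mxtens_index.
under eq_bigr => j _.
  rewrite (bigD1 b)//= big1 ?addr0; last first.
    by move=> c cb; rewrite kron_idE (negbTE cb) !mulr0.
  rewrite kron_idE eqxx mulr1 mxE sum_mxtens_index mulr_suml.
  under eq_bigr => i _.
    rewrite (bigD1 a)//= big1 ?addr0; last first.
      by move=> c ca; rewrite !mxE kron_idE (negbTE ca) mulr0 conjC0 mul0r.
    rewrite !mxE kron_idE eqxx mulr1.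
    over.
  over.
rewrite exchange_big/=; apply: eq_bigr => i _; apply: eq_bigr => j _.
by rewrite mxE.
Qed.

Lemma normalized_dev_le L M (x : 'cV[R[i]]_L) (A : 'M[R[i]]_(L * M)) :
  0 <= normalized_dev x A <= L%:R^-1 * Num.sqrt (frobenius2 (deviation x A)).
Proof.
rewrite /normalized_dev mulr_ge0 ?invr_ge0 ?spectral_norm_ge0//=.
by rewrite ler_wpM2l ?invr_ge0// -deviationE; exact: spectral_norm_le.
Qed.

End Deviation.

(** Induction on n adds the last row and column. Indices are natural numbers because the inner range
    depends on i, as in the evaluation of a quadratic chaos. *)
Lemma sum_square_split (V : nmodType) n (F : nat -> nat -> V) :
  \sum_(i < n) \sum_(j < n) F i j
  = \sum_(i < n) (F i i + \sum_(j < i) (F i j + F j i)).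
Proof.
elim: n => [|n IH]; first by rewrite !big_ord0.
rewrite 2!big_ord_recr /=.
under eq_bigr do rewrite big_ord_recr/=.
rewrite big_ord_recr big_split/= IH -!addrA.
by congr (_ + _); rewrite big_split/= addrC [_ + F n n]addrC -addrA.
Qed.

(** * The deviation as a quadratic chaos *)

Section QuadraticForm.
Context {R : realType}.
Implicit Types x z : R[i].

Definition part (y : bool) z : R := if y then complex.Im z else complex.Re z.

Lemma partD y z z' : part y (z + z') = part y z + part y z'.
Proof. by case: y z z' => -[a b] [a' b']. Qed.

Lemma part_sum y (J : Type) (r : seq J) (F : J -> R[i]) :
  part y (\sum_(j <- r) F j) = \sum_(j <- r) part y (F j).
Proof.
by apply: (big_morph (part y) (partD y)); case: y.
Qed.

Lemma sum_part_sqr z : \sum_y part y z ^+ 2 = Normc.normc z ^+ 2.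
Proof. by rewrite big_bool normc_sqr addrC. Qed.

(* Re x, Im x and |x|^2 - 1 are centered, and a quadratic form in the x_i minus
   its mean is a combination of products of these functions, each product having
   factors with distinct indices i. *)
Definition basis x (t : 'I_3) : R :=
  match val t with
  | 0 => complex.Re x
  | 1 => complex.Im x
  | _ => complex.Re x ^+ 2 + complex.Im x ^+ 2 - 1
  end.

(** From x^* z x - z = (|x|^2 - 1) z: only the third basis function occurs. *)
Definition diag_coef (y : bool) z (t : 'I_3) : R :=
  if val t == 2%N then part y z else 0.

(** For x = r + i s and x' = r' + i s', the form x^* z x' + x'^* z' x equals (r r' + s s') (z + z')
    + i (r s' - s r') (z - z'). Here [p] is the part of z + z' and [o] that of i (z - z'). *)
Definition cross_coef (y : bool) z z' (t t' : 'I_3) : R :=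
  let p := part y z + part y z' in
  let o := if y then complex.Re z - complex.Re z'
           else complex.Im z' - complex.Im z in
  match val t, val t' with
  | 0, 0 | 1, 1 => p
  | 0, 1 => o
  | 1, 0 => - o
  | _, _ => 0
  end.

Lemma part_diag y x z :
  part y (x^* * z * x - z) = \sum_t basis x t * diag_coef y z t.
Proof.
rewrite 3!big_ord_recl big_ord0 /basis /diag_coef /=.
by case: x z => r s [a b]; case: y => /=; ring.
Qed.

Lemma part_cross y x x' z z' :
  part y (x^* * z * x' + x'^* * z' * x)
  = \sum_t basis x t * \sum_t' basis x' t' * cross_coef y z z' t t'.
Proof.
rewrite 3!big_ord_recl big_ord0 /= !big_ord_recl !big_ord0.
rewrite /basis /cross_coef /=.
by case: x x' z z' => r s [r' s'] [a b] [a' b']; case: y => /=; ring.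
Qed.

Lemma sum_diag_coef z :
  \sum_y \sum_t diag_coef y z t ^+ 2 = Normc.normc z ^+ 2.
Proof.
rewrite -sum_part_sqr; apply: eq_bigr => y _.
by rewrite !big_ord_recl big_ord0 /diag_coef /=; ring.
Qed.

(** The parallelogram law: z + z' and i (z - z') each occur twice. *)
Lemma sum_cross_coef z z' :
  \sum_y \sum_t \sum_t' cross_coef y z z' t t' ^+ 2
  = 4 * (Normc.normc z ^+ 2 + Normc.normc z' ^+ 2).
Proof.
rewrite !normc_sqr big_bool /= !big_ord_recl !big_ord0.
rewrite /cross_coef /=; ring.
Qed.

Variables L M : nat.
Implicit Types (v : 'cV[R[i]]_L) (A : 'M[R[i]]_(L * M)).

(* Junk value 0 outside of the range of indices. *)
Definition nat_entry v (i : nat) : R[i] := oapp (fun k => v k 0) 0 (insub i).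

Definition nat_blk A a b (i j : nat) : R[i] :=
  oapp (fun i' => oapp (fun j' => blk A i' j' a b) 0 (insub j)) 0 (insub i).

Lemma nat_entryE v (i : 'I_L) : nat_entry v i = v i 0.
Proof. by rewrite /nat_entry valK. Qed.

Lemma nat_blkE A a b (i j : 'I_L) : nat_blk A a b i j = blk A i j a b.
Proof. by rewrite /nat_blk !valK. Qed.

Lemma part_deviation y v A a b :
  part y (deviation v A a b) = \sum_(i < L) \sum_t basis (nat_entry v i) t *
    (diag_coef y (nat_blk A a b i i) t + \sum_(j < i) \sum_t'
       basis (nat_entry v j) t' *
       cross_coef y (nat_blk A a b i j) (nat_blk A a b j i) t t').
Proof.
rewrite mxE.
transitivity (part y (\sum_(i < L) \sum_(j < L)
  (nat_entry v i)^* * nat_blk A a b i j * nat_entry v j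
  - \sum_(i < L) nat_blk A a b i i)).
  congr (part y (_ - _)); last by apply: eq_bigr => i _; rewrite nat_blkE.
  by apply: eq_bigr => i _; apply: eq_bigr => j _; rewrite nat_blkE !nat_entryE.
rewrite (sum_square_split _ (fun i j =>
  (nat_entry v i)^* * nat_blk A a b i j * nat_entry v j)).
rewrite -sumrB part_sum; apply: eq_bigr => i _.
rewrite addrAC partD part_diag part_sum.
under [X in _ + X]eq_bigr do rewrite part_cross.
rewrite exchange_big/= -big_split/=; apply: eq_bigr => t _.
by rewrite mulrDr; congr (_ + _); rewrite mulr_sumr.
Qed.

(** Every entry of A is counted once: in a diagonal block it costs C, in an off-diagonal block 4
    C^2. The common factor 4 C^2 is allowed since C >= 1. *)
Lemma sum_coef_le (C : R) A : 1 <= C ->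
  \sum_a \sum_b \sum_y C * \sum_(i < L) \sum_t
    (diag_coef y (nat_blk A a b i i) t ^+ 2 + C * \sum_(j < i) \sum_t'
       cross_coef y (nat_blk A a b i j) (nat_blk A a b j i) t t' ^+ 2)
  <= 4 * C ^+ 2 * frobenius2 A.
Proof.
move=> C1; have C0 : 0 <= C by exact: le_trans C1.
pose N a b i j := Normc.normc (nat_blk A a b i j) ^+ 2.
have -> : frobenius2 A = \sum_a \sum_b \sum_(i < L) \sum_(j < L) N a b i j.
  rewrite /frobenius2 sum_mxtens_index exchange_big/=; apply: eq_bigr => a _.
  rewrite [RHS]exchange_big/=; apply: eq_bigr => i _.
  rewrite sum_mxtens_index exchange_big/=; apply: eq_bigr => b _.
  by apply: eq_bigr => j _; rewrite /N nat_blkE mxE.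
rewrite mulr_sumr; apply: ler_sum => a _; rewrite mulr_sumr; apply: ler_sum => b _.
rewrite (sum_square_split _ (N a b)) -mulr_sumr exchange_big/= !mulr_sumr.
apply: ler_sum => i _; rewrite exchange_big/=.
set G := \sum_(j < i) _.
have G0 : 0 <= G by apply: sumr_ge0 => j _; rewrite addr_ge0 ?sqr_ge0.
rewrite (_ : \sum_t _ = N a b i i + C * (4 * G)); last first.
  rewrite exchange_big/=; under eq_bigr do rewrite big_split/= -mulr_sumr.
  rewrite big_split/= sum_diag_coef -mulr_sumr; congr (_ + C * _).
  rewrite mulr_sumr; under eq_bigr do rewrite exchange_big/=.
  by rewrite exchange_big/=; apply: eq_bigr => j _; rewrite sum_cross_coef.
have N0 : 0 <= N a b i i by exact: sqr_ge0.
rewrite -subr_ge0 (_ : _ - _ = C * N a b i i * (4 * C - 1)); last by ring.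
by apply: mulr_ge0; [exact: mulr_ge0|lra].
Qed.

End QuadraticForm.

(** * The moment bound for the deviation *)

Section DeviationMoment.
Context d (T : measurableType d) (R : realType) (P : probability T R).
Variables (L M : nat) (x : T -> 'cV[R[i]]_L) (A : T -> 'M[R[i]]_(L * M)).
Hypothesis A_rv : forall ij, complex_rv (entry A ij).
Hypothesis x_rv : forall ij, complex_rv (entry x ij).
Let rank (ij : 'I_L * 'I_1) : nat := ij.1.

Let rank_inj : injective rank.
Proof. by move=> [i i'] [j j'] /val_inj /= ->; rewrite (ord1 i') (ord1 j'). Qed.

(** For k >= L the junk entry 0 has basis values 0, 0, -1, which are not centered; hence the guards
    [k < n] on the hypotheses of the chaos bound. *)
Let phi k t w := basis (nat_entry (x w) k) t.

Let phiE (i : 'I_L) : phi i = fun t w => basis (entry x (i, 0) w) t.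
Proof. by apply/funext => t; apply/funext => w; rewrite /phi nat_entryE. Qed.

Let G := past (entry x) (entry A) rank.
Let G' := present (entry x) rank.

Let aphi k t : (k < L)%N -> adapted (G' k) (phi k t).
Proof.
move=> kL; rewrite (phiE (Ordinal kL)).
have aRe := @adapted_Re_present _ T R _ (entry x) rank (Ordinal kL, 0).
have aIm := @adapted_Im_present _ T R _ (entry x) rank (Ordinal kL, 0).
rewrite /basis; case: (val t) => [//|[//|_]].
apply: measurable_funB; last exact: measurable_cst.
by apply: measurable_funD; exact: measurable_funX.
Qed.

Let apart_blk y a b i j :
  adapted (G 0%N) (fun w => part y (nat_blk (A w) a b i j)).
Proof.
rewrite /nat_blk; case: insubP => [j' _ _|_] /=; last first.
  by case: y; exact: measurable_cst.
case: insubP => [i' _ _|_] /=; last by case: y; exact: measurable_cst.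
under eq_fun do rewrite mxE.
pose ij := (mxtens.mxtens_index (i', a), mxtens.mxtens_index (j', b)).
by case: y; [exact: (adapted_Im_past ij)
            |exact: (adapted_Re_past ij)].
Qed.

Let adiag y a b i t :
  adapted (G 0%N) (fun w => diag_coef y (nat_blk (A w) a b i i) t).
Proof.
by rewrite /diag_coef; case: (val t == 2%N); [exact: apart_blk|exact: measurable_cst].
Qed.

Let across y a b i j t t' : adapted (G 0%N)
  (fun w => cross_coef y (nat_blk (A w) a b i j) (nat_blk (A w) a b j i) t t').
Proof.
have aRe i' j' := apart_blk false a b i' j'.
have aIm i' j' := apart_blk true a b i' j'.
have ao : adapted (G 0%N) (fun w =>
    if y then complex.Re (nat_blk (A w) a b i j) - complex.Re (nat_blk (A w) a b j i)
    else complex.Im (nat_blk (A w) a b j i) - complex.Im (nat_blk (A w) a b i j)).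
  case: y; apply: measurable_funB; [exact: aRe|exact: aRe|exact: aIm|exact: aIm].
have ap : adapted (G 0%N) (fun w =>
    part y (nat_blk (A w) a b i j) + part y (nat_blk (A w) a b j i)).
  by apply: measurable_funD; exact: apart_blk.
rewrite /cross_coef; case: (val t) => [|[|n]]; case: (val t') => [|[|n']] //=;
  try exact: measurable_cst.
exact: measurable_funN ao.
Qed.

(** One real chaos for each entry of the deviation and each of its two parts. Their squares sum to
    the squared Frobenius norm, which is why [chaos_moment] treats families. *)
Let chaos_of (j : 'I_M * 'I_M * bool) : chaos T R 'I_3 L :=
  quadratic_chaos
    (fun i t w => diag_coef j.2 (nat_blk (A w) j.1.1 j.1.2 i i) t)
    (fun i t i' t' w => cross_coef j.2 (nat_blk (A w) j.1.1 j.1.2 i i')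
       (nat_blk (A w) j.1.1 j.1.2 i' i) t t') L.

Let frobeniusE w : frobenius2 (deviation (x w) (A w))
  = \sum_j 1 * chaos_eval phi (chaos_of j) w ^+ 2.
Proof.
rewrite /frobenius2 pair_bigA /=.
under eq_bigr do rewrite -sum_part_sqr.
rewrite pair_bigA /=; apply: eq_bigr => -[[a b] y] _ /=.
by rewrite mul1r part_deviation quadratic_chaos_eval.
Qed.

Let chaos_of_adapted j : chaos_adapted (G 0%N) (chaos_of j).
Proof. by apply: quadratic_chaos_adapted => *; [exact: adiag|exact: across]. Qed.

Let Gm k : G k `<=` measurable.
Proof. exact: past_measurable. Qed.

Let GG k : (k < L)%N -> G k `<=` <<s G k.+1 >>.
Proof. by move=> _; exact: past_mono. Qed.

Let G'G k : (k < L)%N -> G' k `<=` <<s G k.+1 >>.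
Proof. by move=> _; exact: present_past. Qed.

Lemma measurable_deviation :
  measurable_fun setT (fun w => frobenius2 (deviation (x w) (A w))).
Proof.
under eq_fun do rewrite frobeniusE.
apply: measurable_sum => j; apply: measurable_funM => //.
apply: measurable_funX; apply: adapted_measurable (@Gm L) _.
exact: (chaos_eval_adapted GG G'G aphi (leqnn L) (chaos_of_adapted j)).
Qed.

Variables (q : nat) (K B : R).
Hypothesis A_bnd : {ae P, forall w, spectral_norm (A w) <= B}.
Hypothesis x_indep : mutually_independent P (entry x).
Hypothesis x_A_indep : independent_families P (entry x) (entry A).
Hypothesis x_meanRe : forall ij,
  (\int[P]_w (complex.Re (entry x ij w))%:E = 0)%E.
Hypothesis x_meanIm : forall ij,
  (\int[P]_w (complex.Im (entry x ij w))%:E = 0)%E.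
Hypothesis x_var : forall ij,
  (\int[P]_w (Normc.normc (entry x ij w) ^+ 2)%:E = 1)%E.
Hypothesis K1 : 1 <= K.
Hypothesis basisK : forall ij,
  (\int[P]_w (\sum_t basis (entry x ij w) t ^+ 2)%:E <= K%:E)%E.
Hypothesis basispK : forall ij,
  (\int[P]_w ((\sum_t basis (entry x ij w) t ^+ 2) ^+ q.+2)%:E <= K%:E)%E.

Let mRe ij : measurable_fun setT (fun w => complex.Re (entry x ij w)).
Proof.
apply: adapted_measurable (@adapted_Re_present _ T R _ (entry x) rank ij).
exact: present_measurable.
Qed.

Let mIm ij : measurable_fun setT (fun w => complex.Im (entry x ij w)).
Proof.
apply: adapted_measurable (@adapted_Im_present _ T R _ (entry x) rank ij).
exact: present_measurable.
Qed.

Let mnorm2 ij :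
  measurable_fun setT (fun w => Normc.normc (entry x ij w) ^+ 2).
Proof.
under eq_fun do rewrite normc_sqr.
by apply: measurable_funD; exact: measurable_funX.
Qed.

Let inorm2 ij :
  P.-integrable setT (EFin \o (fun w => Normc.normc (entry x ij w) ^+ 2)).
Proof.
apply/integrableP; split; first exact/measurable_EFinP.
by under eq_integral do rewrite /= ger0_norm ?sqr_ge0//; rewrite x_var ltry.
Qed.

Let icst (r : R) : P.-integrable setT (EFin \o (fun=> r)).
Proof. exact: finite_measure_integrable_cst. Qed.

Let int_cst (r : R) : (\int[P]_w r%:E = r%:E)%E.
Proof.
rewrite integral_cst// -[RHS]mule1; congr (_ * _)%E; exact: probability_setT.
Qed.

Let ibound ij (f : T -> R) : measurable_fun setT f ->
  (forall w, `|f w| <= 1 + Normc.normc (entry x ij w) ^+ 2) ->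
  P.-integrable setT (EFin \o f).
Proof.
move=> mf fb; apply: le_integrable (integrableD _ (icst 1) (inorm2 ij)) => //.
  exact/measurable_EFinP.
by move=> w _ /=; rewrite lee_fin (le_trans (fb w))// ler_norm.
Qed.

(** Integrability of the real and imaginary parts follows from the finite variance, as |a| <= 1 +
    a^2 + b^2. *)
Let cphi k t : (k < L)%N -> centered P (phi k t).
Proof.
move=> kL; rewrite (phiE (Ordinal kL)); set ij := (Ordinal kL, 0).
rewrite /basis; case: (val t) => [|[|_]].
- split=> //; apply: (ibound (ij := ij)) => // w; rewrite normc_sqr.
  set a := complex.Re _; set b := complex.Im _.
  by rewrite ler_norml; apply/andP; split; nra.
- split=> //; apply: (ibound (ij := ij)) => // w; rewrite normc_sqr.
  set a := complex.Re _; set b := complex.Im _.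
  by rewrite ler_norml; apply/andP; split; nra.
- rewrite (_ : (fun w => _) = (fun w => Normc.normc (entry x ij w) ^+ 2 - 1)).
    split; last by rewrite integralB_EFin// x_var int_cst subee.
    by have := integrableB measurableT (inorm2 ij) (icst 1).
  by apply/funext => w; rewrite normc_sqr.
Qed.

Let C : R := step_cst q.+1 * K.

Let C1 : 1 <= C.
Proof. by rewrite -[leLHS]mulr1 ler_pM// step_cst_ge1. Qed.

Let weight_le w : \sum_j 1 * chaos_weight C (chaos_of j) w
  <= 4 * C ^+ 2 * frobenius2 (A w).
Proof.
apply: le_trans (sum_coef_le (A w) C1).
rewrite pair_bigA /= pair_bigA /= le_eqVlt; apply/orP; left; apply/eqP.
by apply: eq_bigr => -[[a b] y] _ /=; rewrite mul1r quadratic_chaos_weight.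
Qed.

Theorem deviation_moment :
  (\int[P]_w (frobenius2 (deviation (x w) (A w)) ^+ q.+2)%:E
   <= ((4 * C ^+ 2 * (L%:R * M%:R * B ^+ 2)) ^+ q.+2)%:E)%E.
Proof.
under eq_integral do rewrite frobeniusE.
apply: le_trans (chaos_moment (G' := G') (n := L) (K := K) Gm _ GG G'G _ aphi cphi
  K1 _ _ (leqnn L) (fun=> ler01) chaos_of_adapted) _.
- by move=> k; exact: present_measurable.
- by move=> k kL; 
  exact: (@filtration_indep _ _ _ _ _ _ _ _ _ rank_inj x_rv A_rv x_indep x_A_indep
    (Ordinal kL, 0)).
- by move=> k kL; rewrite (phiE (Ordinal kL)); exact: basisK.
- by move=> k kL; rewrite (phiE (Ordinal kL)); exact: basispK.
rewrite (_ : (_ ^+ _)%:E = \int[P]_w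
    ((4 * C ^+ 2 * (L%:R * M%:R * B ^+ 2)) ^+ q.+2)%:E)%E; last first.
  by rewrite int_cst.
have mweight : measurable_fun setT
    (fun w => (\sum_j 1 * chaos_weight C (chaos_of j) w) ^+ q.+2).
  apply: measurable_funX; apply: measurable_sum => j; apply: measurable_funM => //.
  by apply: adapted_measurable (@Gm 0%N) _; exact: chaos_weight_adapted.
have C0 : 0 <= C by exact: le_trans C1.
have weight0 k (c : chaos T R 'I_3 k) w : 0 <= chaos_weight C c w.
  elim: k c => [|k IH] c /=; first exact: sqr_ge0.
  apply: addr_ge0 => //; apply: mulr_ge0 => //.
  by apply: sumr_ge0 => t _; exact: IH.
have sum0 w : 0 <= \sum_j 1 * chaos_weight C (chaos_of j) w.
  by apply: sumr_ge0 => j _; rewrite mul1r.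
have LMB0 : 0 <= L%:R * M%:R * B ^+ 2.
  by apply: mulr_ge0; [exact: mulr_ge0|exact: sqr_ge0].
have C40 : 0 <= 4 * C ^+ 2 by apply: mulr_ge0 => //; exact: sqr_ge0.
have bound0 : 0 <= 4 * C ^+ 2 * (L%:R * M%:R * B ^+ 2) by exact: mulr_ge0.
apply: ae_ge0_le_integral => //.
- by move=> w _; rewrite lee_fin exprn_ge0.
- exact/measurable_EFinP.
- by move=> w _; rewrite lee_fin exprn_ge0.
- apply: filterS A_bnd => w sB _; rewrite lee_fin.
  (* The sign of [B] is read off at a point where the norm bound holds. *)
  have B0 : 0 <= B by exact: le_trans (spectral_norm_ge0 _) sB.
  rewrite lerXn2r ?nnegrE//.
  apply: le_trans (weight_le w) _; apply: ler_wpM2l => //.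
  apply: le_trans (frobenius2_le _) _; rewrite natrM; apply: ler_wpM2l; first exact: mulr_ge0.
  by rewrite lerXn2r ?nnegrE ?spectral_norm_ge0.
Qed.

End DeviationMoment.

(** * From summable moments to almost sure smallness *)

Section AlmostSure.
Context d (T : measurableType d) (R : realType) (P : probability T R).

Lemma nneseries_inv_sqr (c : R) : 0 <= c ->
  (\sum_(n <oo) (c * (n.+1%:R ^+ 2)^-1)%:E <= (2 * c)%:E)%E.
Proof.
move=> c0; apply: lime_le.
  apply: is_cvg_nneseries => n _ _; rewrite lee_fin.
  by rewrite mulr_ge0// invr_ge0 exprn_ge0.
apply: nearW => n; rewrite sumEFin lee_fin -mulr_sumr mulrC ler_wpM2r//.
(* Telescoping: 1 / m^2 <= 2 / m - 2 / (m + 1) for m >= 1. *)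
suff : \sum_(0 <= i < n) (i.+1%:R ^+ 2)^-1 <= 2 - 2 / n.+1%:R :> R.
  by move/le_trans; apply; rewrite gerBl divr_ge0.
elim: n => [|n IH]; first by rewrite big_nil divr1 subrr.
rewrite big_nat_recr//= (le_trans (lerD IH (lexx _)))//.
have m1 : (1 : R) <= n.+1%:R by rewrite ler1n.
rewrite -(natr1 n.+1); move: (n.+1%:R : R) m1 => m m1.
have e : 2 - 2 / (m + 1) - (2 - 2 / m + (m ^+ 2)^-1)
    = (m - 1) / (m ^+ 2 * (m + 1)).
  by field; apply/andP; split; apply: lt0r_neq0; lra.
rewrite -subr_ge0 e divr_ge0 ?subr_ge0// mulr_ge0 ?sqr_ge0//; lra.
Qed.

(** The series of the [f n] has finite expectation, so it converges almost surely and its tails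
    vanish; each term is at most the tail that it starts. One null set serves all [e]. *)
Lemma ae_eventually_le (f : nat -> T -> R) (c : R) :
  0 <= c -> (forall n, measurable_fun setT (f n)) -> (forall n w, 0 <= f n w) ->
  (forall n, (\int[P]_w (f n w)%:E <= (c * (n.+1%:R ^+ 2)^-1)%:E)%E) ->
  {ae P, forall w, forall e : R, 0 < e ->
     exists N, forall n, (N <= n)%N -> f n w <= e}.
Proof.
move=> c0 mf f0 If.
have mfE n : measurable_fun setT (EFin \o f n) by exact/measurable_EFinP.
pose g w := (\sum_(n <oo) (f n w)%:E)%E.
have mg : measurable_fun setT g.
  have := @ge0_emeasurable_sum _ _ _ setT (fun n w => (f n w)%:E) xpredT.
  by apply=> [n w _ _|n _]; [rewrite lee_fin|exact: mfE].
have g0 w : (0 <= g w)%E by apply: nneseries_ge0 => n _ _; rewrite lee_fin.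
have ig : P.-integrable setT g.
  apply/integrableP; split=> //.
  under eq_integral do rewrite gee0_abs//.
  rewrite /g integral_nneseries//; last by move=> n w _; rewrite lee_fin.
  apply: (@le_lt_trans _ _ (2 * c)%:E); last exact: ltry.
  apply: le_trans (nneseries_inv_sqr c0).
  by apply: lee_nneseries => // n _ _; apply: integral_ge0 => w _; rewrite lee_fin.
have := integrable_ae measurableT ig.
apply: filterS => w /(_ Logic.I) gw e e0.
have goo : (\sum_(0 <= n <oo) (f n w)%:E < +oo)%E.
  by rewrite -/(g w) -ge0_fin_numE.
have := nneseries_tail_cvg goo (fun k _ => f0 k w).
move/fine_cvgP => [fint cvgt].
have [N1 _ H1] := fint.
have [N2 _ H2] : \forall N \near \oo,
    `|0 - fine (\sum_(N <= k <oo) (f k w)%:E)%E| <= e.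
  by move/cvgrPdist_le : cvgt => /(_ e e0).
exists (maxn N1 N2) => n; rewrite geq_max => /andP[nN1 nN2].
rewrite -lee_fin; apply: (@le_trans _ _ (\sum_(n <= k <oo) (f k w)%:E)%E).
  apply: le_trans (nneseries_lim_ge n.+1 _); last by move=> k _ _; rewrite lee_fin.
  by rewrite big_nat1.
rewrite -(fineK (H1 n nN1)) lee_fin.
by have /= := H2 n nN2; rewrite sub0r normrN; apply: le_trans; exact: ler_norm.
Qed.

Variables (D : nat -> nat -> T -> R) (S : nat -> seq nat) (q : nat) (c c' : R).
Hypothesis c'0 : 0 <= c'.
Hypothesis mD : forall M L, measurable_fun setT (D M L).
Hypothesis D0 : forall M L w, 0 <= D M L w.
Hypothesis D_moment : forall M L, (\int[P]_w (D M L w ^+ q.+2)%:E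
  <= ((c * (L%:R * M%:R)) ^+ q.+2)%:E)%E.
Hypothesis S_sum : forall L,
  \sum_(M <- S L.+1) (c * (M%:R / L.+1%:R)) ^+ q.+2 <= c' * (L.+1%:R ^+ 2)^-1.

(** For each L the powers are summed over all M in [S L] before taking expectations. A small sum
    forces each term to be small, whence uniformity in M. *)
Lemma ae_uniformly_small : {ae P, forall w, forall e : R, 0 < e ->
  exists N, forall L M, (N <= L)%N -> M \in S L -> L%:R^-1 * Num.sqrt (D M L w) <= e}.
Proof.
pose f n w := \sum_(M <- S n.+1) (D M n.+1 w / n.+1%:R ^+ 2) ^+ q.+2.
have term0 M n w : 0 <= (D M n.+1 w / n.+1%:R ^+ 2) ^+ q.+2.
  by rewrite exprn_ge0// divr_ge0// exprn_ge0.
have mterm M n : measurable_fun setT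
    (fun w => (D M n.+1 w / n.+1%:R ^+ 2) ^+ q.+2).
  by apply: measurable_funX; apply: measurable_funM.
have If n : (\int[P]_w (f n w)%:E <= (c' * (n.+1%:R ^+ 2)^-1)%:E)%E.
  rewrite /f; under eq_integral do rewrite -sumEFin.
  rewrite ge0_integral_sum//; last 2 first.
  - by move=> M; exact/measurable_EFinP.
  - by move=> M w _; rewrite lee_fin.
  apply: le_trans (_ : _ <= (\sum_(M <- S n.+1) (c * (M%:R / n.+1%:R)) ^+ q.+2)%:E)%E _.
    rewrite -sumEFin; apply: lee_sum => M _.
    under eq_integral => w _ do rewrite exprMn mulrC EFinM.
    rewrite ge0_integralZl//; last 2 first.
    - by apply/measurable_EFinP; exact: measurable_funX.
    - by move=> w _; rewrite lee_fin exprn_ge0.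
    have n0 : (n.+1%:R : R) != 0 by [].
    rewrite (_ : c * (M%:R / n.+1%:R)
      = (n.+1%:R ^+ 2)^-1 * (c * (n.+1%:R * M%:R))); last by field.
    rewrite exprMn [leRHS]EFinM; apply: lee_wpmul2l; last exact: D_moment.
    by rewrite lee_fin exprn_ge0// invr_ge0 exprn_ge0.
  by rewrite lee_fin.
have := ae_eventually_le c'0 (fun n => measurable_sum _ (mterm ^~ n))
  (fun n w => sumr_ge0 _ (fun M _ => term0 M n w)) If.
apply: filterS => w H e e0.
have [N HN] := H ((e ^+ 2) ^+ q.+2) (exprn_gt0 _ (exprn_gt0 _ e0)).
(* The series runs over L = n + 1; the shift also excludes L = 0. *)
exists N.+1 => -[//|L] M; rewrite ltnS => NL MS.
have := HN L NL.
rewrite (big_rem M)//= => HL.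
have {HL} : (D M L.+1 w / L.+1%:R ^+ 2) ^+ q.+2 <= (e ^+ 2) ^+ q.+2.
  by apply: le_trans HL; rewrite lerDl sumr_ge0.
rewrite ler_pXn2r ?nnegrE ?divr_ge0 ?sqr_ge0//.
rewrite ler_pdivrMr ?exprn_gt0// => HL.
rewrite ler_pdivrMl// -[leRHS]ger0_norm; last by rewrite mulr_ge0// ltW.
by rewrite -sqrtr_sqr ler_wsqrtr// exprMn mulrC.
Qed.

End AlmostSure.

Section Summability.
Context {R : realType}.

(** Each term is of order L^(-p (1 - delta)), hence at most of order L^(-3). One power of L pays for
    the number of admissible M, leaving the summable L^(-2). *)
Lemma sum_power_range (c c1 delta : R) q : 0 <= c -> 0 <= c1 -> delta < 1 ->
  3 <= q.+2%:R * (1 - delta) ->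
  exists S : nat -> seq nat, exists2 c' : R, 0 <= c' &
  (forall L, \sum_(M <- S L.+1) (c * (M%:R / L.+1%:R)) ^+ q.+2
     <= c' * (L.+1%:R ^+ 2)^-1) /\
  (forall M L, (0 < L)%N -> M%:R <= c1 * L%:R `^ delta -> M \in S L).
Proof.
move=> c0 c10 d1 q3.
pose N := (Num.trunc c1).+1.
have c1N : c1 <= N%:R by apply: ltW; exact: truncnS_gt.
(* The cutoff loses no admissible M: L^delta <= L for L >= 1, and [c1 <= N%:R]. *)
pose S L := [seq M <- iota 0 (N * L).+1 | M%:R <= c1 * L%:R `^ delta].
exists S, (N.+1%:R * (c * c1) ^+ q.+2).
  by apply: mulr_ge0 => //; apply: exprn_ge0; exact: mulr_ge0.
split=> [L|M L L0 ML]; last first.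
  rewrite mem_filter ML mem_iota /= add0n ltnS -(ler_nat R).
  apply: le_trans ML _; rewrite natrM ler_pM ?powR_ge0//.
  by rewrite -[leRHS]powRr1// ler_powR ?ler1n// ltW.
set l : R := L.+1%:R.
have l1 : 1 <= l by rewrite ler1n.
have l0 : 0 < l by exact: lt_le_trans l1.
pose X : R := (c * c1) ^+ q.+2 * (l ^+ 3)^-1.
have X0 : 0 <= X.
  by rewrite mulr_ge0 ?invr_ge0 ?exprn_ge0// ?mulr_ge0// ltW.
have termX M : M%:R <= c1 * l `^ delta -> (c * (M%:R / l)) ^+ q.+2 <= X.
  move=> ML.
  have lp : (l `^ delta / l) ^+ q.+2 <= (l ^+ 3)^-1.
    rewrite (_ : l `^ delta / l = l `^ (delta - 1)); last first.
      by rewrite powRB ?powRr1 ?(gt_eqF l0) ?implybT// ltW.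
    rewrite -powR_mulrn ?powR_ge0// -powRrM -(powR_mulrn 3 (ltW l0)) -powRN.
    by rewrite ler_powR//; lra.
  apply: (@le_trans _ _ ((c * c1 * (l `^ delta / l)) ^+ q.+2)).
    rewrite lerXn2r ?nnegrE//.
    - by apply: mulr_ge0 => //; apply: divr_ge0 => //; exact: ltW.
    - apply: mulr_ge0; first exact: mulr_ge0.
      by apply: divr_ge0; [exact: powR_ge0|exact: ltW].
    - by rewrite -mulrA ler_wpM2l// mulrA ler_wpM2r// invr_ge0 ltW.
  rewrite exprMn /X; apply: ler_wpM2l lp.
  by apply: exprn_ge0; exact: mulr_ge0.
apply: (@le_trans _ _ (\sum_(M <- S L.+1) X)).
  rewrite big_seq [leRHS]big_seq; apply: ler_sum => M.
  by rewrite mem_filter => /andP[ML _]; exact: termX.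
rewrite big_const_seq count_predT iter_addr_0 -[leLHS]mulr_natl.
have sS : (size (S L.+1))%:R <= N.+1%:R * l.
  rewrite -natrM ler_nat size_filter (leq_trans (count_size _ _))// size_iota.
  by rewrite mulSn addnC -addn1 leq_add2l.
apply: (@le_trans _ _ (N.+1%:R * l * X)); first exact: (ler_wpM2r X0 sS).
rewrite /X le_eqVlt; apply/orP; left; apply/eqP.
by field; rewrite gt_eqF.
Qed.

Lemma sum_basis_sqr (z : R[i]) : \sum_t basis z t ^+ 2
  = Normc.normc z ^+ 2 + (Normc.normc z ^+ 2 - 1) ^+ 2.
Proof. by rewrite !big_ord_recl big_ord0 normc_sqr /basis /=; ring. Qed.

End Summability.

Section Assembly.
Context d (T : measurableType d) (R : realType) (P : probability T R).
Variables (A : forall M L : nat, T -> 'M[R[i]]_(L * M)).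
Variables (x : forall L : nat, T -> 'cV[R[i]]_L).
Hypothesis A_rv : forall M L ij, complex_rv (entry (A M L) ij).
Variable B : R.
Hypothesis A_bnd : forall M L, {ae P, forall w, spectral_norm (A M L w) <= B}.
Hypothesis x_rv : forall L ij, complex_rv (entry (x L) ij).
Hypothesis x_indep : forall L, mutually_independent P (entry (x L)).
Hypothesis x_meanRe : forall L ij,
  (\int[P]_w (complex.Re (entry (x L) ij w))%:E = 0)%E.
Hypothesis x_meanIm : forall L ij,
  (\int[P]_w (complex.Im (entry (x L) ij w))%:E = 0)%E.
Hypothesis x_var : forall L ij,
  (\int[P]_w (Normc.normc (entry (x L) ij w) ^+ 2)%:E = 1)%E.
Hypothesis x_A_indep : forall M L,
  independent_families P (entry (x L)) (entry (A M L)).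
Variables (q : nat) (K : R).
Hypothesis K1 : 1 <= K.
Hypothesis basisK : forall L ij,
  (\int[P]_w (\sum_t basis (entry (x L) ij w) t ^+ 2)%:E <= K%:E)%E.
Hypothesis basispK : forall L ij,
  (\int[P]_w ((\sum_t basis (entry (x L) ij w) t ^+ 2) ^+ q.+2)%:E <= K%:E)%E.

(* The factor of L * M in the moment bound of [deviation_moment]. *)
Definition deviation_cst : R := 4 * (step_cst q.+1 * K) ^+ 2 * B ^+ 2.

Lemma deviation_cst_ge0 : 0 <= deviation_cst.
Proof.
apply: mulr_ge0; last exact: sqr_ge0.
by apply: mulr_ge0 => //; exact: sqr_ge0.
Qed.

(** Both convergences are instances: [S L] is a single M for the first, and a range growing with L
    for the second. *)
Lemma ae_normalized_dev (S : nat -> seq nat) (c' : R) : 0 <= c' ->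
  (forall L, \sum_(M <- S L.+1) (deviation_cst * (M%:R / L.+1%:R)) ^+ q.+2
     <= c' * (L.+1%:R ^+ 2)^-1) ->
  {ae P, forall w, forall e : R, 0 < e -> exists N, forall L M, (N <= L)%N ->
     M \in S L -> normalized_dev (x L w) (A M L w) <= e}.
Proof.
move=> c'0 Sc'.
have := @ae_uniformly_small _ _ _ P
  (fun M L w => frobenius2 (deviation (x L w) (A M L w))) S q deviation_cst c' c'0.
move=> H; apply: filterS (H _ _ _ Sc').
- move=> w Hw e /Hw [N HN]; exists N => L M NL MS.
  apply: le_trans (HN L M NL MS).
  by have /andP[] := normalized_dev_le (x L w) (A M L w).
- move=> M L; exact: (measurable_deviation (@A_rv M L) (@x_rv L)).
- move=> M L w; exact: frobenius2_ge0.
- move=> M L; apply: le_trans (deviation_moment (@A_rv M L) (@x_rv L) (A_bnd M L)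
    (@x_indep L) (@x_A_indep M L) (@x_meanRe L) (@x_meanIm L) (@x_var L) K1
    (@basisK L) (@basispK L)) _.
  rewrite lee_fin le_eqVlt; apply/orP; left; apply/eqP.
  by congr (_ ^+ _); rewrite /deviation_cst; ring.
Qed.

End Assembly.

(** * Moments of the centered basis functions *)

Section BasisMoments.
Context d (T : measurableType d) (R : realType) (P : probability T R).
Variable (X : T -> R[i]).
Hypothesis X_rv : complex_rv X.

Let m w := Normc.normc (X w) ^+ 2.

Let m0 w : 0 <= m w. Proof. exact: sqr_ge0. Qed.

Let mm : measurable_fun setT m.
Proof.
have mRe : measurable_fun setT (fun w => complex.Re (X w)).
  move=> _ C mC; rewrite setTI.
  exact: X_rv (complex_borel_Re mC).
have mIm : measurable_fun setT (fun w => complex.Im (X w)).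
  move=> _ C mC; rewrite setTI.
  exact: X_rv (complex_borel_Im mC).
rewrite /m; under eq_fun do rewrite normc_sqr.
by apply: measurable_funD; exact: measurable_funX.
Qed.

Let mbasis : measurable_fun setT (fun w => \sum_t basis (X w) t ^+ 2).
Proof.
under eq_fun do rewrite sum_basis_sqr.
apply: measurable_funD => //; apply: measurable_funX.
exact: measurable_funB.
Qed.

Let basis0 w : 0 <= \sum_t basis (X w) t ^+ 2.
Proof. by apply: sumr_ge0 => t _; exact: sqr_ge0. Qed.

Let int_cst (r : R) : (\int[P]_w r%:E = r%:E)%E.
Proof.
rewrite integral_cst// -[RHS]mule1; congr (_ * _)%E; exact: probability_setT.
Qed.

Lemma basis_moment_bounded (chi : R) p :
  {ae P, forall w, Normc.normc (X w) <= chi} ->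
  (\int[P]_w ((\sum_t basis (X w) t ^+ 2) ^+ p)%:E
   <= ((chi ^+ 2 + (chi ^+ 2 + 1) ^+ 2) ^+ p)%:E)%E.
Proof.
move=> Xchi; rewrite -[leRHS]int_cst.
have b0 : 0 <= chi ^+ 2 + (chi ^+ 2 + 1) ^+ 2 by rewrite addr_ge0 ?sqr_ge0.
apply: ae_ge0_le_integral => //.
- by move=> w _; rewrite lee_fin exprn_ge0.
- by apply/measurable_EFinP; exact: measurable_funX.
- by move=> w _; rewrite lee_fin exprn_ge0.
- apply: filterS Xchi => w Xw _; rewrite lee_fin lerXn2r ?nnegrE//.
  rewrite sum_basis_sqr -/(m w).
  have mchi : m w <= chi ^+ 2.
    by rewrite lerXn2r ?nnegrE ?normc_ge0// (le_trans _ Xw) ?normc_ge0.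
  by have := m0 w; nra.
Qed.

Variable kappa : R.
Hypothesis X8 : (\int[P]_w (Normc.normc (X w) ^+ 8)%:E <= kappa%:E)%E.

(** Here m^4 = |X|^8. The absolute value of [kappa] makes the bound at least 1, as the constant of
    the chaos estimate must be. *)
Let moment8_le (f : T -> R) : measurable_fun setT f -> (forall w, 0 <= f w) ->
  (forall w, f w <= 2 + 2 * m w ^+ 4) ->
  (\int[P]_w (f w)%:E <= (2 + 2 * `|kappa|)%:E)%E.
Proof.
move=> mf f0 fm.
have mm4 : measurable_fun setT (fun w => m w ^+ 4) by exact: measurable_funX.
apply: (@le_trans _ _ (\int[P]_w (2%:E + 2%:E * (m w ^+ 4)%:E))%E).
  apply: ge0_le_integral => //.
  - by move=> w _; rewrite lee_fin.
  - exact/measurable_EFinP.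
  - apply/measurable_EFinP; apply: measurable_funD => //.
    exact: measurable_funM.
  - by move=> w _; rewrite -EFinM -EFinD lee_fin.
rewrite ge0_integralD//; last 2 first.
- by move=> w _; rewrite -EFinM lee_fin mulr_ge0// exprn_ge0.
- by apply/measurable_EFinP; exact: measurable_funM.
rewrite ge0_integralZl//; last 2 first.
- exact/measurable_EFinP.
- by move=> w _; rewrite lee_fin exprn_ge0.
rewrite int_cst -[leRHS]/(2%:E + 2%:E * `|kappa|%:E)%E leeD2l// lee_wpmul2l//.
under eq_integral do rewrite /m -exprM.
by apply: le_trans X8 _; rewrite lee_fin ler_norm.
Qed.

Lemma basis_moment2 :
  (\int[P]_w (\sum_t basis (X w) t ^+ 2)%:E <= (2 + 2 * `|kappa|)%:E)%E.
Proof.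
apply: moment8_le => // w; rewrite sum_basis_sqr -/(m w).
have := m0 w; move: (m w) => a a0; have := sqr_ge0 (a ^+ 2 - 1).
rewrite (_ : (a ^+ 2 - 1) ^+ 2 = a ^+ 4 - 2 * a ^+ 2 + 1); last by ring.
by have := sqr_ge0 (a ^+ 2); rewrite -exprM; nra.
Qed.

(** The sum of squares is at most 1 + m^2, of degree 4 in |X|, so its square calls for the eighth
    moment; (1 + m^2)^2 <= 2 + 2 m^4. *)
Lemma basis_moment4 :
  (\int[P]_w ((\sum_t basis (X w) t ^+ 2) ^+ 2)%:E <= (2 + 2 * `|kappa|)%:E)%E.
Proof.
apply: moment8_le => [|w|w].
- exact: measurable_funX.
- exact: sqr_ge0.
rewrite sum_basis_sqr -/(m w).
have := m0 w; move: (m w) => a a0.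
have h : a + (a - 1) ^+ 2 <= 1 + a ^+ 2 by nra.
have h0 : 0 <= a + (a - 1) ^+ 2 by rewrite addr_ge0 ?sqr_ge0.
apply: (@le_trans _ _ ((1 + a ^+ 2) ^+ 2)).
  by rewrite lerXn2r ?nnegrE// (le_trans h0 h).
have := sqr_ge0 (a ^+ 2 - 1).
rewrite (_ : (a ^+ 2 - 1) ^+ 2 = a ^+ 4 - 2 * a ^+ 2 + 1); last by ring.
rewrite (_ : (1 + a ^+ 2) ^+ 2 = a ^+ 4 + 2 * a ^+ 2 + 1); last by ring.
by lra.
Qed.

End BasisMoments.

Local Close Scope complex_scope.
Unset Implicit Arguments.

(** The joint limit along an arbitrary filter [F] covers sequences of pairs as well as restricted
    regions. One null set suffices, because the almost sure bound holds for all pairs with M in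
    [S L] and L large at once. *)
Theorem proposition3 (d : measure_display) (T : measurableType d)
  (R : realType) (P : probability T R)
  (A : forall M L : nat, T -> 'M[R[i]%C]_(L * M))
  (x : forall L : nat, T -> 'cV[R[i]%C]_L)
  (A_rv : forall M L ij, complex_rv (entry (A M L) ij))
  (A_herm : forall M L, {ae P, forall w, A M L w \is hermsymmx})
  (A_bnd : exists K : R, forall M L,
     {ae P, forall w, spectral_norm (A M L w) <= K})
  (x_rv : forall L ij, complex_rv (entry (x L) ij))
  (x_indep : forall L, mutually_independent P (entry (x L)))
  (x_idd : forall L, identically_distributed P (entry (x L)))
  (x_meanRe : forall L ij, ('E_P[fun w => complex.Re (entry (x L) ij w)] = 0)%E)
  (x_meanIm : forall L ij, ('E_P[fun w => complex.Im (entry (x L) ij w)] = 0)%E)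
  (x_var : forall L ij,
     ('E_P[fun w => (Normc.normc (entry (x L) ij w) ^+ 2)%R] = 1)%E)
  (x_mom8 : exists kappa : R, forall L ij,
     ('E_P[fun w => (Normc.normc (entry (x L) ij w) ^+ 8)%R] <= kappa%:E)%E)
  (x_A_indep : forall M L,
     independent_families P (entry (x L)) (entry (A M L))) :
  (forall M : nat,
     {ae P, forall w, normalized_dev (x L w) (A M L w) @[L --> \oo] --> (0 : R)})
  /\
  ((exists2 chi : R, 0 < chi & forall L ij,
      {ae P, forall w, Normc.normc (entry (x L) ij w) <= chi}) ->
   forall (F : set_system (nat * nat)) (delta : R), ProperFilter F ->
   fst @ F --> \oo -> snd @ F --> \oo ->
   0 < delta < 1 ->
   (limf_esup (fun ML => (ML.1%:R * ML.2%:R `^ (- delta))%:E) F < +oo)%E ->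
   {ae P, forall w,
      normalized_dev (x ML.2 w) (A ML.1 ML.2 w) @[ML --> F] --> (0 : R)}).
Proof.
have [B {}A_bnd] := A_bnd; have [kappa {}x_mom8] := x_mom8.
have meanRe L ij : (\int[P]_w (complex.Re (entry (x L) ij w))%:E = 0)%E.
  by rewrite -(x_meanRe L ij) unlock.
have meanIm L ij : (\int[P]_w (complex.Im (entry (x L) ij w))%:E = 0)%E.
  by rewrite -(x_meanIm L ij) unlock.
have var L ij : (\int[P]_w (Normc.normc (entry (x L) ij w) ^+ 2)%:E = 1)%E.
  by rewrite -(x_var L ij) unlock.
have main q K := ae_normalized_dev (q := q) (K := K) A_rv A_bnd x_rv x_indep
  meanRe meanIm var x_A_indep.
split=> [M|[chi chi0 x_chi] F delta FF F1 F2 /andP[d0 d1] Fsup].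
  have mom8 L ij : (\int[P]_w (Normc.normc (entry (x L) ij w) ^+ 8)%:E <= kappa%:E)%E.
    by apply: le_trans (x_mom8 L ij); rewrite unlock.
  pose K := 2 + 2 * `|kappa|.
  have K1 : 1 <= K by have := normr_ge0 kappa; rewrite /K; lra.
  have basis2K L ij :
      (\int[P]_w ((\sum_t basis (entry (x L) ij w) t ^+ 2) ^+ 2)%:E <= K%:E)%E.
    exact: (basis_moment4 (x_rv L ij) (mom8 L ij)).
  have basis1K L ij :
      (\int[P]_w (\sum_t basis (entry (x L) ij w) t ^+ 2)%:E <= K%:E)%E.
    exact: (basis_moment2 (x_rv L ij) (mom8 L ij)).
  pose c := deviation_cst B 0 K.
  (* The exponent is 2, that is [q = 0]: for a single fixed M the sum is already of order L^(-2). *)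
  have Sc L : \sum_(N <- [:: M]) (c * (N%:R / L.+1%:R)) ^+ 2
      <= (c * M%:R) ^+ 2 * (L.+1%:R ^+ 2)^-1.
    by rewrite big_seq1 mulrA [leLHS]exprMn exprVn.
  have := main 0%N K K1 basis1K basis2K (fun=> [:: M]) _ (sqr_ge0 _) Sc.
  apply: filterS => w Hw; apply/cvgrPdist_le => e e0.
  have [N HN] := Hw e e0.
  exists N => //= L NL; rewrite sub0r normrN ger0_norm.
    by apply: HN => //; rewrite inE.
  by have /andP[] := normalized_dev_le (x L w) (A M L w).
have [q q3] : exists q, 3 <= q.+2%:R * (1 - delta).
  exists (Num.trunc (3 / (1 - delta))); rewrite -ler_pdivrMr ?subr_gt0//.
  by apply: ltW; apply: lt_trans (truncnS_gt _) _; rewrite ltr_nat.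
(* The upper limit is an infimum of suprema over sets of [F]; its finiteness yields one set [V] with
   a finite bound on it. *)
have [_ [V FV <-] Vsup] := ereal_inf_lt Fsup.
have [c1 c10 c1V] : exists2 c1 : R, 0 <= c1 & forall ML, V ML -> (0 < ML.2)%N ->
    ML.1%:R <= c1 * ML.2%:R `^ delta.
  (* The supremum is below +oo by [Vsup] and above -oo because some pair lies in [V], so [fine]
     keeps its value. *)
  exists `|fine (ereal_sup [set (ML.1%:R * ML.2%:R `^ (- delta))%:E | ML in V])| => //.
  move=> [M L] VML /= L0.
  have Lp : 0 < L%:R `^ delta :> R by rewrite powR_gt0// ltr0n.
  rewrite -ler_pdivrMr// -powRN.
  have ub := @ereal_sup_ubound _ [set (ML.1%:R * ML.2%:R `^ (- delta))%:E | ML in V]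
    (M%:R * L%:R `^ (- delta))%:E.
  have {}ub := ub (ex_intro2 _ _ (M, L) VML erefl).
  apply: le_trans (ler_norm _); rewrite -lee_fin fineK//.
  rewrite fin_numElt Vsup andbT; exact: lt_le_trans (ltNyr _) ub.
pose b := chi ^+ 2 + (chi ^+ 2 + 1) ^+ 2.
(* One constant above 1, [b] and [b ^+ q.+2], so that it bounds both moments. *)
pose K := 1 + b + b ^+ q.+2.
have b0 : 0 <= b by rewrite addr_ge0 ?sqr_ge0.
have bq0 : 0 <= b ^+ q.+2 by rewrite exprn_ge0.
have K1 : 1 <= K by rewrite /K; lra.
have basis1K L ij :
    (\int[P]_w (\sum_t basis (entry (x L) ij w) t ^+ 2)%:E <= K%:E)%E.
  have := basis_moment_bounded (x_rv L ij) 1%N (x_chi L ij).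
  under eq_integral do rewrite expr1.
  by move/le_trans; apply; rewrite expr1 lee_fin -/b /K; lra.
have basisqK L ij :
    (\int[P]_w ((\sum_t basis (entry (x L) ij w) t ^+ 2) ^+ q.+2)%:E <= K%:E)%E.
  have := basis_moment_bounded (x_rv L ij) q.+2 (x_chi L ij).
  by move/le_trans; apply; rewrite lee_fin -/b /K; lra.
have [S [c' c'0 [Sc HS]]] :=
  sum_power_range (deviation_cst_ge0 B q K) c10 d1 q3.
have := main q K K1 basis1K basisqK S c' c'0 Sc.
apply: filterS => w Hw; apply/cvgrPdist_le => e e0.
have [N HN] := Hw e e0.
(* [N.+1] instead of [N] guarantees L > 0, which the bound on M requires. *)
have FN : \forall ML \near F, (N.+1 <= ML.2)%N.
  by apply: (F2 [set n | (N.+1 <= n)%N]); exists N.+1.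
apply: filterS2 FV FN => -[M L] VML /= NL; rewrite sub0r normrN ger0_norm.
  apply: HN; first exact: ltnW.
  apply: HS; first exact: leq_ltn_trans NL.
  by apply: (c1V (M, L)) => //; exact: leq_ltn_trans NL.
by have /andP[] := normalized_dev_le (x L w) (A M L w).
Qed.
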